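(* Let $n\ge5$ and let $\boldsymbol\lambda\in K_n$ be such that $G_{\boldsymbol\lambda}$ is isomorphic to the octahedral group $O\simeq S_4$. According to the type of $\boldsymbol\lambda$ (with $m\in\mathbb{N}=\{0,1,2,\dots\}$), its multiplicity vector is: 1. type F+mB: $(m,\,m,\,1+3m,\,3m,\,2m)$; 2. type V+mB: $(m,\,m,\,1+3m,\,3m,\,1+2m)$; 3. type E+mB: $(m,\,1+m,\,1+3m,\,1+3m,\,1+2m)$; 4. type FV+mB: $(m,\,m,\,2+3m,\,1+3m,\,1+2m)$; 5. type VE+mB: $(m,\,1+m,\,2+3m,\,2+3m,\,2+2m)$; 6. type EF+mB: $(m,\,1+m,\,2+3m,\,2+3m,\,1+2m)$; 7. type FVE+mB: $(m,\,1+m,\,3+3m,\,3+3m,\,2+2m)$; 8. type (1+m)B: $(1+m,\,1+m,\,3+3m,\,2+3m,\,2+2m)$.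
   Context: $K_n=\{\boldsymbol\lambda=(\lambda^1,\dots,\lambda^{n-3})\in\mathbb{C}^{n-3}\mid \lambda^i\neq 0,1,\ \lambda^i\neq\lambda^j \text{ for } i\neq j\}$. For $\boldsymbol\lambda\in K_n$ put $z^{\boldsymbol\lambda}_1=0$, $z^{\boldsymbol\lambda}_2=1$, $z^{\boldsymbol\lambda}_3=\infty$, $z^{\boldsymbol\lambda}_{i+3}=\lambda^i$, and $[\boldsymbol\lambda]=\{z^{\boldsymbol\lambda}_1,\dots,z^{\boldsymbol\lambda}_n\}\subset\widehat{\mathbb{C}}$. For $\sigma\in S_n$, $f^{\boldsymbol\lambda}_\sigma$ is the unique linear fractional transformation (LFT) sending $z^{\boldsymbol\lambda}_{\sigma^{-1}(1)},z^{\boldsymbol\lambda}_{\sigma^{-1}(2)},z^{\boldsymbol\lambda}_{\sigma^{-1}(3)}$ to $0,1,\infty$, and $g_\sigma:K_n\to K_n$, $g_\sigma(\boldsymbol\lambda)=(f^{\boldsymbol\lambda}_\sigma(z^{\boldsymbol\lambda}_{\sigma^{-1}(4)}),\dots,f^{\boldsymbol\lambda}_\sigma(z^{\boldsymbol\lambda}_{\sigma^{-1}(n)}))$. $G=\{g_\sigma\}$ is a group under composition ($g_\pi g_\sigma=g_{\pi\sigma}$; for $n\ge5$, $\sigma\mapsto g_\sigma$ is injective), and $G_{\boldsymbol\lambda}$ is the stabilizer of $\boldsymbol\lambda$ in $G$. $X_{\boldsymbol\lambda}:G_{\boldsymbol\lambda}\to \mathrm{GL}_{n-3}(\mathbb{C})$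 is the representation sending $g_\sigma$ to the Jacobian matrix of $g_\sigma$ at $\boldsymbol\lambda$. Types. Two subsets of $\widehat{\mathbb{C}}\cong S^2$ (stereographic projection) are equivalent if an LFT carries one onto the other. Fix a cube inscribed in $S^2$ with rotation group $O$; $V_O$ is its vertex set, $F_O$ and $E_O$ the radial projections to $S^2$ of its face centers and edge midpoints; $B_O(a)$ denotes an $O$-orbit of order $24$. $\boldsymbol\lambda$ is of type F+mB, V+mB, E+mB, FV+mB, VE+mB, EF+mB, FVE+mB if $[\boldsymbol\lambda]$ is equivalent to the union of, respectively, $F_O$; $V_O$; $E_O$; $F_O\cup V_O$; $V_O\cup E_O$; $E_O\cup F_O$; $F_O\cup V_O\cup E_O$ with $m$ distinct orbits $B_O(a_1),\dots,B_O(a_m)$ of order $24$; it is of type (1+m)B if $[\boldsymbol\lambda]$ is equivalent to a union of $m+1$ distinct orbits $B_O(a_0),\dots,B_O(a_m)$ of order $24$. (Every $\boldsymbol\lambda$ with $G_{\boldsymbol\lambda}\simeq O$ is of one of these types.) Multiplicity vector. Let $\Psi_{\boldsymbol\lambda}:G_{\boldsymbol\lambda}\to S_4$ be an isomorphism. Conjugacy classes: $K^{(1)}$ the identity; $K^{(2)},K^{(3)},K^{(4)},K^{(5)}$ the elements whose images under $\Psi_{\boldsymbol\lambda}$ are conjugate to $(1234)$, $(123)$, $(12)(34)$, $(12)$, respectively. The irreducible representations $X^{(1)},\dots,X^{(5)}$ have characters with values on $(K^{(1)},\dots,K^{(5)})$: $\chi^{(1)}=(1,1,1,1,1)$, $\chi^{(2)}=(1,-1,1,1,-1)$,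 $\chi^{(3)}=(3,-1,0,-1,1)$, $\chi^{(4)}=(3,1,0,-1,-1)$, $\chi^{(5)}=(2,0,-1,2,0)$. If $X_{\boldsymbol\lambda}\cong p_1X^{(1)}\oplus\cdots\oplus p_5X^{(5)}$, the multiplicity vector of $\boldsymbol\lambda$ is $(p_1,\dots,p_5)$. *)

(* Defs.v *)
From mathcomp Require Import all_boot all_order all_algebra all_fingroup.
From mathcomp Require Import mxrepresentation character complex.
From mathcomp Require Import all_classical all_reals all_analysis.

Set Implicit Arguments.
Unset Strict Implicit.
Unset Printing Implicit Defensive.

Import Order.TTheory GRing.Theory Num.Theory.
Import numFieldNormedType.Exports.

Local Open Scope classical_set_scope.
Local Open Scope ring_scope.
Local Open Scope complex_scope.

(* The field of complex numbers is [R[i]] with [R : realType], and the Riemann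
   sphere is [option R[i]], with [None] as the point at infinity. *)
Section Moebius.
Context {R : realType}.
Local Notation C := R[i].

Definition mobius (a b c d : C) (z : option C) : option C :=
  match z with
  | Some z => if c * z + d == 0 then None
              else Some ((a * z + b) / (c * z + d))
  | None => if c == 0 then None else Some (a / c)
  end.

Definition is_lft (f : option C -> option C) : Prop :=
  exists a b c d : C, a * d - b * c != 0 /\ f = mobius a b c d.

Definition lft_equiv (A B : set (option C)) : Prop :=
  exists f, is_lft f /\ f @` A = B.

End Moebius.

(* Throughout, [d] stands for [n - 3]. The index set {1, ..., n} is
   ['I_(3 + d)]: the indices 1, 2, 3 are the [lshift d j] and the indices
   4, ..., n are the [rshift 3 j]. *)
Section Configurations.
Context {R : realType} {d : nat}.
Local Notation C := R[i].
Implicit Types (l : 'rV[C]_d) (s : 'S_(3 + d)).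

Definition Kconf : set 'rV[C]_d :=
  [set l | (forall i, l 0 i != 0 /\ l 0 i != 1) /\ injective (l 0)].

Definition zero_one_oo (j : 'I_3) : option C :=
  nth None [:: Some 0; Some 1; None] j.

Definition zpt l (i : 'I_(3 + d)) : option C :=
  match fintype.split i with
  | inl j => zero_one_oo j
  | inr j => Some (l 0 j)
  end.

(* For [l] in [Kconf] there is exactly one LFT as described, and [get] returns
   it. *)
Definition flft l s : option C -> option C :=
  get [set f | is_lft f /\
    forall j : 'I_3, f (zpt l (s^-1%g (lshift d j))) = zero_one_oo j].

(* A self-map of [Kconf] is represented by its extension to ['rV_d] by the
   identity, so that composition and equality of such extensions are those of
   the self-maps of [Kconf]. On [Kconf] the values of [flft] selected below are
   finite, and the default value 0 is not used. *)
Definition gmap s l : 'rV[C]_d :=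
  if l \in Kconf
  then \row_j odflt 0 (flft l s (zpt l (s^-1%g (rshift 3 j))))
  else l.

Definition Ggroup : set ('rV[C]_d -> 'rV[C]_d) := range gmap.

Definition Gstab l : set ('rV[C]_d -> 'rV[C]_d) :=
  [set g | Ggroup g /\ g l = l].

(* ['J g l] acts on row vectors from the right; its transpose has the usual
   entries, the derivative of the i-th component of g along the j-th coordinate
   in row i and column j. *)
Definition Xrep l (g : 'rV[C]_d -> 'rV[C]_d) : 'M[C]_d := ('J g l)^T.

(* The product of ['S_4] composes permutations from left to right. Inversion
   identifies this group with the one for the other convention and preserves
   the cycle types. *)
Definition Gstab_isom l (Psi : ('rV[C]_d -> 'rV[C]_d) -> 'S_4) : Prop :=
  set_bij (Gstab l) setT Psi /\
  forall g h, Gstab l g -> Gstab l h -> Psi (g \o h) = (Psi g * Psi h)%g.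

End Configurations.

Section OctahedralOrbits.
Context {R : realType}.
Local Notation C := R[i].
Local Notation point := 'rV[R]_3.

Definition norm2 (v : point) : R := Num.sqrt (\sum_i v 0 i ^+ 2).

Definition sphere2 : set point := [set v | norm2 v = 1].

Definition radial (v : point) : point := (norm2 v)^-1 *: v.

(* Stereographic projection from the north pole (0, 0, 1). *)
Definition stereo (v : point) : option C :=
  if v 0 (inord 2) == 1 then None
  else Some ((v 0 (inord 0) / (1 - v 0 (inord 2))) +i*
             (v 0 (inord 1) / (1 - v 0 (inord 2)))).

(* The cube is the one with vertices (+-1, +-1, +-1) / sqrt 3. Up to scaling,
   its face centers, edge midpoints and vertices are the vectors with
   coordinates in {-1, 0, 1} of which exactly 1, 2 and 3, respectively, are
   nonzero. *)
Definition cube_points (k : nat) : set point :=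
  radial @` [set v : point | (forall i, v 0 i \in [:: -1; 0; 1]) /\
                     #|[set i | v 0 i != 0]%SET| = k].

Definition F_O : set point := cube_points 1.
Definition E_O : set point := cube_points 2.
Definition V_O : set point := cube_points 3.

Definition rotO : set 'M[R]_3 :=
  [set A | [/\ A *m A^T = 1%:M, \det A = 1 & (mulmx^~ A) @` V_O = V_O]].

Definition orbO (a : point) : set point := (mulmx a) @` rotO.

(* [l] has type [base] + [m] B. *)
Definition has_type (d : nat) (base : set point) (m : nat)
    (l : 'rV[C]_d) : Prop :=
  exists a : 'I_m -> point,
    [/\ forall k, sphere2 (a k) /\ (orbO (a k) #= `I_24)%card,
        injective (fun k => orbO (a k)) &
        lft_equiv (range (zpt l))
                  (stereo @` (base `|` \bigcup_k orbO (a k)))].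

End OctahedralOrbits.

Section Multiplicities.
Context {R : realType}.
Local Notation C := R[i].

Local Notation S4 := [set: 'S_4]%G.

Definition swap4 (a b : nat) : 'S_4 := tperm (inord a) (inord b).

(* Representatives of K^(1), ..., K^(5), that is, 1, (1234), (123), (12)(34)
   and (12), on the letters 0, ..., 3. *)
Definition class_repr (k : 'I_5) : 'S_4 :=
  nth 1%g [:: 1; swap4 0 1 * swap4 0 2 * swap4 0 3; swap4 0 1 * swap4 0 2;
              swap4 0 1 * swap4 2 3; swap4 0 1]%g k.

Definition char_table (j k : 'I_5) : int :=
  nth 0 (nth [::] [:: [:: 1;  1;  1;  1;  1];
                      [:: 1; -1;  1;  1; -1];
                      [:: 3; -1;  0; -1;  1];
                      [:: 3;  1;  0; -1; -1];
                      [:: 2;  0; -1;  2;  0]] j) k.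

Definition S4_irreps (X : 'I_5 -> representation C S4) : Prop :=
  forall j, mx_irreducible (X j) /\
    forall k s, s \in (class_repr k ^: S4)%g ->
      \tr (X j s) = (char_table j k)%:~R.

(* The representation of [Gstab l] is transported to ['S_4] along [Psi], and
   [p] lists p_1, ..., p_5. The choice of [X] is immaterial, representations
   being determined by their characters up to isomorphism. *)
Definition multiplicity_vector (d : nat) (l : 'rV[C]_d)
    (Psi : ('rV[C]_d -> 'rV[C]_d) -> 'S_4) (p : 5.-tuple nat) : Prop :=
  forall X : 'I_5 -> representation C S4, S4_irreps X ->
    exists rX : mx_representation C S4 d,
      (forall g, Gstab l g -> rX (Psi g) = Xrep l g) /\
      mx_rsim rX (\big[dadd_grepr/grepr0]_(j < 5) muln_grepr (X j) (tnth p j)).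

End Multiplicities.

(* Main.v *)
From HB Require Import structures.
Require Import Defs.
From mathcomp Require Import all_boot all_order all_algebra all_fingroup.
From mathcomp Require Import pgroup mxrepresentation character complex.
From mathcomp Require Import all_classical all_reals all_analysis.
From mathcomp Require Import ring lra zify.

Set Implicit Arguments.
Unset Strict Implicit.
Unset Printing Implicit Defensive.

Import Order.TTheory GRing.Theory Num.Theory.
Import numFieldNormedType.Exports.

Local Open Scope classical_set_scope.
Local Open Scope ring_scope.
Local Open Scope complex_scope.

(** Why the multiplicities are what they are.

    Near [l] the space [Kconf] is the space of configurations of [3 + d]
    distinct points of the sphere up to LFTs, so its tangent space at [l] is the
    direct sum of the tangent lines of the sphere at the points of [l], divided
    by the three-dimensional space sl_2 of the quadratic vector fields, the
    infinitesimal LFTs.  If [gmap s] fixes [l], it does so because an LFT f with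
    matrix M permutes the points of [l], and it acts on this quotient through f.
    Hence the trace of its Jacobian is the sum of the derivatives of f at the
    points of [l] that f fixes, minus the trace of f on sl_2, which is
    (tr M)^2 / det M - 1 (lemma [mxtrace_Xrep]).  If f has two fixed points in
    [l], the two derivatives are inverse to each other with sum
    (tr M)^2 / det M - 2, and the trace of the Jacobian is -1; if f has no fixed
    point in [l], the trace is 1 - (tr M)^2 / det M.  To make the quotient
    explicit, a point c off the configuration is sent to infinity, after which
    all the points are finite ([wpt]) and [gmap s] permutes them and then takes
    cross-ratios ([gmap_coord]); the quotient by sl_2 becomes an identity between
    matrices ([mxtrace_section]).

    Let now an LFT carry [l] onto the stereographic image of a union S of orbits
    of the cube group.  Two quarter turns of the cube, which are the LFTs iz and
    (z + 1) / (1 - z), preserve S, and so do the products of them: a half turn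
    about a face axis, the square of a quarter turn; a third of a turn about a
    vertex axis; and a half turn about an edge axis.  The axis of such a rotation
    ends at face centers, vertices or edge midpoints, and so lies in S exactly
    when the orbit of these points is a part of S: a free orbit cannot contain
    them, because the orbit of each has at most 12 elements.  Since no nontrivial
    rotation among these acts on the tangent space with trace d, their images
    under [Psi] have the expected orders, which together with parity determine
    their conjugacy classes in the symmetric group.  With [F], [V], [E] the 0-1
    indicators of the three special orbits, the character of [Xrep] is therefore
    (d, -1, -[V], 1 - 2[F], 1 - 2[E]), and d = 6[F] + 8[V] + 12[E] + 24m - 3
    by counting points ([octa_charE], [config_card]).

    The characters of the irreducible representations being linearly
    independent, this determines the multiplicities, once it is known that every
    representation is a direct sum of the given five; they are all the
    irreducible ones because the squares of their degrees sum to 24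
    ([rsim_dsum_mult]).  The result is best seen orbit by orbit: a free orbit
    contributes the regular representation (1, 1, 3, 3, 2), the faces contribute
    (0, 0, 1, 1, 0), the vertices (0, 0, 1, 1, 1), the edges (0, 1, 1, 2, 1), and
    the quotient by sl_2, on which the group acts as on three-space, removes
    (0, 0, 0, 1, 0) ([multiplicity_vector_octahedral]). *)

(** * Decomposition into given irreducible representations *)

Section Multiplicities.
Variables (F : closedFieldType) (gT : finGroupType) (G : {group gT}).
Hypothesis F'G : ([pchar F]^'.-group G)%g.

Lemma mxtrace_rsim n1 n2 (r1 : mx_representation F G n1)
    (r2 : mx_representation F G n2) x :
  mx_rsim r1 r2 -> x \in G -> \tr (r1 x) = \tr (r2 x).
Proof.
case/mx_rsim_def=> B [B' BK def_r1] Gx.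
by rewrite def_r1 // mxtrace_mulC mulmxA BK mul1mx.
Qed.

Lemma mxtrace_dsum (J : finType) (X : J -> representation F G) x :
  x \in G -> \tr ((\big[dadd_grepr/grepr0]_j X j) x) = \sum_j \tr (X j x).
Proof.
move=> Gx; elim/big_rec2: _ => [|j _ r _ <-]; first by rewrite mxtrace1.
exact: mxtrace_block.
Qed.

Lemma mxtrace_muln (X : representation F G) k x :
  x \in G -> \tr (muln_grepr X k x) = \tr (X x) *+ k.
Proof. by move=> Gx; rewrite mxtrace_dsum // sumr_const card_ord. Qed.

(** The map from [J] to the types of irreducible representations is injective
    by hypothesis; it is onto because the degrees of all the types also have
    squares that sum to the order of [G].  The isotypic components of the
    representation can then be indexed by [J]. *)
Lemma rsim_dsum_mult (J : finType) (X : J -> representation F G)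
    n (r : mx_representation F G n) :
    (forall j, mx_irreducible (X j)) ->
    (forall i j, mx_rsim (X i) (X j) -> i = j) ->
    (\sum_j rdegree (X j) ^ 2)%N = #|G| ->
  exists p : J -> nat,
    mx_rsim r (\big[dadd_grepr/grepr0]_j muln_grepr (X j) (p j)).
Proof.
move=> irrX injX degX.
pose iG : irrType F G := DecSocleType (regular_repr F G).
pose c j := irr_comp iG (X j).
have cX j : mx_rsim (X j) (irr_repr (c j)).
  by have := rsim_irr_comp_pchar iG F'G (irrX j).
have c_inj : injective c.
  move=> i j eq_c; apply: injX; apply: mx_rsim_trans (cX i) _.
  by rewrite eq_c; apply: mx_rsim_sym.
have c_onto i : i \in codom c.
  apply: contraT => ci'; have := sum_irr_degree_pchar iG F'G.
  move/(_ (@group_closure_closed_field F gT G)) => sum_iG.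
  have: (\sum_(k in codom c) irr_degree k ^ 2 = #|G|)%N.
    have uc : uniq (codom c) by rewrite map_inj_uniq ?enum_uniq.
    rewrite -degX -(big_uniq _ uc) big_map big_enum /=.
    by apply: eq_bigr => j _; rewrite (mxrank_rsim (cX j)).
  have := irr_degree_gt0 i; move: sum_iG.
  rewrite (bigID (fun k => k \in codom c)) /= => + + eqG.
  rewrite eqG (bigD1 i) //= => /eqP.
  by rewrite -{2}[#|G|]addn0 eqn_add2l addn_eq0 expn_eq0 /= andbT => /andP[/eqP->].
pose sG := DecSocleType r.
have idx_ex (W : sG) : exists j, irr_comp iG (socle_repr W) == c j.
  by have /codomP[j ->] := c_onto (irr_comp iG (socle_repr W)); exists j.
pose f W := xchoose (idx_ex W).
have fP W : mx_rsim (socle_repr W) (X (f W)).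
  apply: mx_rsim_trans (rsim_irr_comp_pchar iG F'G (socle_irr W)) _.
  by rewrite (eqP (xchooseP (idx_ex W))); apply: mx_rsim_sym.
have f_inj : injective f.
  move=> V W eq_f; apply/eqP/socle_rsimP; apply: mx_rsim_trans (fP V) _.
  by rewrite eq_f; apply: mx_rsim_sym.
pose W j : option sG := [pick V | f V == j].
pose U j := oapp (fun V : sG => socle_val V) 0 (W j).
have sumU : (\sum_j U j)%MS = Socle sG.
  rewrite /Socle (partition_big f xpredT) //=; apply: eq_bigr => j _.
  rewrite /U /W; case: pickP => [V /eqP <- | noV]; last by rewrite big_pred0.
  by rewrite (big_pred1 V) // => V'; rewrite /= (inj_eq f_inj).
have rankU : (\sum_j \rank (U j))%N = (\sum_(V : sG) \rank V)%N.
  rewrite [RHS](partition_big f xpredT) //=; apply: eq_bigr => j _.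
  rewrite /U /W; case: pickP => [V /eqP <- | noV]; last by rewrite big_pred0 ?mxrank0.
  by rewrite (big_pred1 V) // => V'; rewrite /= (inj_eq f_inj).
have dxU : mxdirect (\sum_j U j).
  by rewrite mxdirectE /= sumU rankU (mxdirectP (Socle_direct sG)).
have U1 : (\sum_j U j :=: 1%:M)%MS.
  by rewrite sumU (reducible_Socle1 sG (mx_Maschke_pchar r F'G)).
pose modU j : mxmodule r (U j) :=
  if W j is Some V as oV return mxmodule r (oapp (fun V : sG => socle_val V) 0 oV)
  then component_mx_module r (socle_base V) else mxmodule0 r n.
exists (fun j => oapp (@socle_mult _ _ _ _ _ sG) 0%N (W j)).
apply: mx_rsim_trans (mx_rsim_sym (rsim_submod1 (mxmodule1 r) _)) _ => //.
apply: mx_rsim_dsum (modU) _ U1 dxU _ => j.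
rewrite /modU /U; case defW: (W j) => [V|]; last first.
  rewrite /muln_grepr big_ord0; exists 0 => [||x _]; rewrite ?mulmx0 ?mul0mx //.
    by rewrite /= mxrank0.
  by rewrite /row_free /= !mxrank0.
rewrite /=; apply: mx_rsim_socle; have [<-] : Some (f V) = Some j; last exact: fP.
by move: defW; rewrite /W; case: pickP => // V' /eqP <- [->].
Qed.
End Multiplicities.

(** * Representations of the symmetric group on four letters *)

Section OctahedralCharacters.
Variable R : realType.
Local Notation C := R[i].
Local Notation S4 := [set: 'S_4]%G.

Lemma pchar'_pgroup (gT : finGroupType) (G : {group gT}) :
  ([pchar C]^'.-group G)%g.
Proof.
by apply/pgroupP => p _ _; rewrite inE /= pchar_num.
Qed.

Lemma in_S4 (s : 'S_4) : s \in S4.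
Proof. by rewrite inE. Qed.

Lemma S4_irreps_trace (X : 'I_5 -> representation C S4) j k :
  S4_irreps X -> \tr (X j (class_repr k)) = (char_table j k)%:~R.
Proof. by case/(_ j)=> _; apply; exact: class_refl. Qed.

(** Degrees are traces at the identity, and the field has characteristic 0. *)
Lemma S4_irreps_degree (X : 'I_5 -> representation C S4) :
  S4_irreps X -> forall j : 'I_5, rdegree (X j) = nth 0%N [:: 1; 1; 3; 3; 2]%N j.
Proof.
move=> irrX j; have := S4_irreps_trace j ord0 irrX.
rewrite [class_repr _]/= repr_mx1 mxtrace1 => /eqP.
rewrite -[_%:R]/((rdegree (X j))%:Z%:~R) eqr_int => /eqP.
by case: j => -[|[|[|[|[|]]]]] //= ?; case.
Qed.

Lemma sum_ord5 (f : 'I_5 -> int) :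
  \sum_j f j =
  f (inord 0) + f (inord 1) + f (inord 2) + f (inord 3) + f (inord 4).
Proof.
rewrite !big_ord_recl big_ord0 addr0 !addrA.
by congr (f _ + f _ + f _ + f _ + f _); apply/val_inj; rewrite /= inordK.
Qed.

(** The trace of a direct sum is the combination of the rows of the character
    table given by the multiplicities, and the table is an invertible matrix. *)
Lemma rsim_char_table (X : 'I_5 -> representation C S4) (p : 5.-tuple nat)
    n (r : mx_representation C S4 n) :
    S4_irreps X ->
    (forall k, \tr (r (class_repr k)) =
               (\sum_j char_table j k * (tnth p j)%:Z)%:~R) ->
  mx_rsim r (\big[dadd_grepr/grepr0]_(j < 5) muln_grepr (X j) (tnth p j)).
Proof.
move=> irrX tr_r.
have [i j simX||q rsim_r] :=
  rsim_dsum_mult (@pchar'_pgroup _ S4) r (fun j => (irrX j).1).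
- have eq_row k : char_table i k == char_table j k.
    have := mxtrace_rsim simX (in_S4 (class_repr k)).
    by rewrite !(S4_irreps_trace _ _ irrX) => /eqP; rewrite eqr_int.
  have := conj (eq_row (inord 1)) (eq_row (inord 2)) => /andP.
  rewrite /char_table !inordK //; apply: contraTeq.
  case: i j {simX eq_row} => -[|[|[|[|[|]]]]] //= ? [] [|[|[|[|[|]]]]] //= ?.
- rewrite !big_ord_recl big_ord0 !(S4_irreps_degree irrX) cardsT.
  by rewrite -[#|_|]/#|'S_4| card_Sn.
suff -> : (\big[dadd_grepr/grepr0]_(j < 5) muln_grepr (X j) (tnth p j)) =
          \big[dadd_grepr/grepr0]_(j < 5) muln_grepr (X j) (q j) by [].
apply: eq_bigr => j _; congr muln_grepr.
have tr_q k : \sum_j char_table j k * (tnth p j)%:Z =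
              \sum_j char_table j k * (q j)%:Z.
  have := mxtrace_rsim rsim_r (in_S4 (class_repr k)); rewrite tr_r.
  rewrite mxtrace_dsum ?in_S4 //.
  under [X in _ = X -> _]eq_bigr => i _ do
    rewrite mxtrace_muln ?in_S4 // (S4_irreps_trace _ _ irrX) -mulr_natr
      -[(q i)%:R]/((q i)%:Z%:~R) -intrM.
  by rewrite -rmorph_sum /= => /eqP; rewrite eqr_int => /eqP.
have {tr_q} := (tr_q (inord 0), tr_q (inord 1), tr_q (inord 2), tr_q (inord 3),
                tr_q (inord 4)).
rewrite !sum_ord5 /char_table !inordK //= -[j]inord_val.
by case: j => -[|[|[|[|[|]]]]] //= _ [[[[]]]] *; lia.
Qed.

End OctahedralCharacters.

(** * LFTs as two-by-two matrices *)

Section MobiusMatrices.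
Context {R : realType}.
Local Notation C := R[i].
Implicit Types (M N : 'M[C]_2) (z : option C).

Definition mx2 (a b c d : C) : 'M[C]_2 :=
  \matrix_(i < 2, j < 2) nth 0 (nth [::] [:: [:: a; b]; [:: c; d]] i) j.

Definition mob M : option C -> option C :=
  mobius (M 0 0) (M 0 1) (M 1 0) (M 1 1).

Lemma mob_mx2 a b c d : mob (mx2 a b c d) = mobius a b c d.
Proof. by rewrite /mob !mxE. Qed.

Lemma mx2E M : M = mx2 (M 0 0) (M 0 1) (M 1 0) (M 1 1).
Proof.
apply/matrixP => i j; rewrite !mxE.
by case: i j => -[|[|//]] ? [] [|[|//]] ? /=; congr (M _ _); apply: val_inj.
Qed.

Lemma sum_ord2 (f : 'I_2 -> C) : \sum_i f i = f 0 + f 1.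
Proof. by rewrite !big_ord_recl big_ord0 addr0; congr (_ + f _); apply: val_inj. Qed.

Lemma det_mx2 M : \det M = M 0 0 * M 1 1 - M 0 1 * M 1 0.
Proof.
have lift01 : lift 0 0 = 1 :> 'I_2 by apply: val_inj.
have lift10 : lift 1 0 = 0 :> 'I_2 by apply: val_inj.
rewrite (expand_det_row _ 0) sum_ord2 /cofactor !det_mx11 !mxE /= lift01 lift10.
by rewrite expr0 expr1 mul1r mulN1r mulrN.
Qed.

Lemma mxtrace_mx2 M : \tr M = M 0 0 + M 1 1.
Proof. exact: sum_ord2. Qed.

Lemma mulmx2 M N i j : (M *m N) i j = M i 0 * N 0 j + M i 1 * N 1 j.
Proof. by rewrite mxE sum_ord2. Qed.

Lemma is_lft_mob (f : option C -> option C) :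
  is_lft f <-> exists2 M, \det M != 0 & f = mob M.
Proof.
split=> [[a [b [c [d [nz ->]]]]]|[M nz ->]].
  by exists (mx2 a b c d); rewrite ?mob_mx2 // det_mx2 !mxE.
by exists (M 0 0), (M 0 1), (M 1 0), (M 1 1); rewrite -det_mx2.
Qed.

(** The point with homogeneous coordinates [x], [y].  Homogeneous coordinates
    spare the separate treatment of infinity in compositions of LFTs. *)
Definition hpt (x y : C) : option C := if y == 0 then None else Some (x / y).

Definition hx z : C := if z is Some z then z else 1.
Definition hy z : C := if z is Some _ then 1 else 0.

Lemma hptK z : hpt (hx z) (hy z) = z.
Proof. by case: z => [z|]; rewrite /hpt /= ?oner_eq0 ?divr1 ?eqxx. Qed.

Lemma hxy_neq0 z : (hx z != 0) || (hy z != 0).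
Proof. by case: z => [z|] /=; rewrite oner_eq0 ?orbT. Qed.

Lemma mob_hpt M x y : (x != 0) || (y != 0) ->
  mob M (hpt x y) = hpt (M 0 0 * x + M 0 1 * y) (M 1 0 * x + M 1 1 * y).
Proof.
rewrite /mob /hpt; have [-> /= /[!orbF] nzx|nzy _ /=] := eqVneq y 0.
  rewrite !mulr0 !addr0 mulIr_eq0; last exact/mulIf.
  by case: eqP => //= /eqP nzc; congr Some; field; rewrite nzx.
have -> : M 1 0 * (x / y) + M 1 1 = (M 1 0 * x + M 1 1 * y) / y by field.
rewrite mulIr_eq0; last exact/mulIf/invr_neq0.
by case: eqP => // /eqP nzc; congr Some; field; rewrite nzc nzy.
Qed.

Lemma mob_neq0 M z : \det M != 0 ->
  (M 0 0 * hx z + M 0 1 * hy z != 0) || (M 1 0 * hx z + M 1 1 * hy z != 0).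
Proof.
rewrite det_mx2; apply: contraNT; rewrite negb_or !negbK.
set x := _ + _ * hy z; set y := _ + _ * hy z => /andP[/eqP x0 /eqP y0].
have ex : (M 0 0 * M 1 1 - M 0 1 * M 1 0) * hx z = M 1 1 * x - M 0 1 * y.
  by rewrite /x /y; ring.
have ey : (M 0 0 * M 1 1 - M 0 1 * M 1 0) * hy z = M 0 0 * y - M 1 0 * x.
  by rewrite /x /y; ring.
move: ex ey; rewrite x0 y0 !mulr0 subr0 => /eqP ex /eqP ey.
move: ex ey (hxy_neq0 z); rewrite !mulf_eq0; case: eqP => //= _ /eqP-> /eqP->.
by rewrite eqxx.
Qed.

Lemma mobE M z :
  mob M z = hpt (M 0 0 * hx z + M 0 1 * hy z) (M 1 0 * hx z + M 1 1 * hy z).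
Proof. by rewrite -{1}[z]hptK mob_hpt ?hxy_neq0. Qed.

Lemma mobM M N : \det N != 0 -> mob (M *m N) = mob M \o mob N.
Proof.
move=> nzN; apply/funext => z /=.
rewrite [mob N z]mobE mob_hpt ?mob_neq0 //.
by rewrite mobE !mulmx2; congr hpt; ring.
Qed.

Lemma mobZ k M : k != 0 -> mob (k *: M) = mob M.
Proof.
move=> nzk; apply/funext => z; rewrite !mobE !mxE /hpt.
rewrite -!mulrA -!mulrDr mulrI_eq0; last exact/mulfI.
by case: eqP => // /eqP nz; congr Some; field; rewrite nz.
Qed.

Lemma mob1 : mob 1%:M = id.
Proof.
apply/funext => z; rewrite mobE !mxE /=.
by rewrite !mul1r !mul0r addr0 add0r hptK.
Qed.

Lemma mob_unit M : \det M != 0 -> M \in unitmx.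
Proof. by rewrite unitmxE unitfE. Qed.

Lemma det_invmx_neq0 M : \det M != 0 -> \det (invmx M) != 0.
Proof. by rewrite det_inv invr_eq0. Qed.

Lemma mobK M : \det M != 0 -> cancel (mob M) (mob (invmx M)).
Proof.
move=> nzM z; rewrite -[LHS]/((mob _ \o mob _) z) -mobM //.
by rewrite mulVmx ?mob_unit // mob1.
Qed.

Lemma mob_inj M : \det M != 0 -> injective (mob M).
Proof. by move=> nzM; apply: can_inj (mobK nzM). Qed.

Lemma hpt_eq x y z : (x != 0) || (y != 0) ->
  hpt x y = z <-> x * hy z = y * hx z.
Proof.
rewrite /hpt; case: z => [z|]; have [-> /= /[!orbF] nzx|nzy _] := eqVneq y 0 => /=.
- by split=> // /eqP; rewrite mulr1 mul0r (negPf nzx).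
- rewrite mulr1; split=> [[<-]|->]; last by congr Some; field.
  by field.
- by rewrite mulr0 mul0r.
- by split=> // /esym/eqP; rewrite mulr0 mulr1 (negPf nzy).
Qed.

Lemma mob_eq M z w : \det M != 0 -> mob M z = w <->
  (M 0 0 * hx z + M 0 1 * hy z) * hy w = (M 1 0 * hx z + M 1 1 * hy z) * hx w.
Proof. by move=> nzM; rewrite mobE hpt_eq ?mob_neq0. Qed.

Lemma mob_fix_some M (z : C) : \det M != 0 -> mob M (Some z) = Some z ->
  M 1 0 * z ^+ 2 + (M 1 1 - M 0 0) * z - M 0 1 = 0.
Proof.
move=> nzM /(mob_eq _ _ nzM) /= /eqP; rewrite -subr_eq0 => /eqP e.
by rewrite -[LHS]opprK -[RHS]oppr0 -e; congr (- _); ring.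
Qed.

Lemma mob_fix_none M : \det M != 0 -> mob M None = None -> M 1 0 = 0.
Proof. by move=> nzM /(mob_eq _ _ nzM) /=; rewrite !mulr0 mulr1 addr0 mulr1. Qed.

Lemma mob_fix2_some M (z w : C) : \det M != 0 -> z != w ->
  mob M (Some z) = Some z -> mob M (Some w) = Some w ->
  M 1 0 * (z + w) = M 0 0 - M 1 1.
Proof.
rewrite -(subr_eq0 z) => nzM nzzw /(mob_fix_some nzM) ez /(mob_fix_some nzM) ew.
apply: (mulIf nzzw); apply/eqP; rewrite -subr_eq0; apply/eqP.
by rewrite -[RHS](subrr 0) -{1}ez -ew; ring.
Qed.

(** The fixed points of an LFT are the roots of a quadratic equation, so a
    third one makes the matrix scalar. *)
Lemma mob_fix3 M z0 z1 z2 : \det M != 0 -> uniq [:: z0; z1; z2] ->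
  mob M z0 = z0 -> mob M z1 = z1 -> mob M z2 = z2 -> mob M = id.
Proof.
move=> nzM uz.
suff fixM (z w : C) : z != w -> M 1 0 = 0 -> mob M (Some z) = Some z ->
    mob M (Some w) = Some w -> mob M = id.
  case: z0 z1 z2 uz => [z0|] [z1|] [z2|] //=;
    rewrite !inE ?(inj_eq (@Some_inj _)) ?andbT ?andbF ?negb_or //=.
  - case/andP=> /andP[n01 n02] n12 f0 f1 f2.
    apply: (fixM z0 z1) => //.
    have := mob_fix2_some nzM n01 f0 f1; rewrite -(mob_fix2_some nzM n02 f0 f2).
    move/eqP; rewrite -subr_eq0 -mulrBr opprD addrACA subrr add0r mulf_eq0.
    by rewrite subr_eq0 (negPf n12) orbF => /eqP.
  - case/andP => n01 _ f0 f1 /(mob_fix_none nzM) f2; exact: (fixM z0 z1).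
  - by move=> n02 f0 /(mob_fix_none nzM) f1 f2; exact: (fixM z0 z2).
  - by move=> n12 /(mob_fix_none nzM) f0 f1 f2; exact: (fixM z1 z2).
move=> nzw M10 fz fw; have := mob_fix2_some nzM nzw fz fw.
rewrite M10 mul0r => /esym/eqP; rewrite subr_eq0 => /eqP M00.
have := mob_fix_some nzM fz; rewrite M10 M00 mul0r subrr mul0r !add0r.
move/eqP; rewrite oppr_eq0 => /eqP M01.
have nz11 : M 1 1 != 0.
  by move: nzM; rewrite det_mx2 M10 mulr0 subr0 mulf_eq0 => /norP[].
rewrite -mob1 -(mobZ 1%:M nz11); congr mob; rewrite [LHS]mx2E [RHS]mx2E.
by rewrite !mxE /= M10 M00 M01 /= !mulr0 !mulr1.
Qed.

Lemma lft_uniq (f g : option C -> option C) z0 z1 z2 :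
  is_lft f -> is_lft g -> uniq [:: z0; z1; z2] ->
  f z0 = g z0 -> f z1 = g z1 -> f z2 = g z2 -> f = g.
Proof.
move=> /is_lft_mob[M nzM ->] /is_lft_mob[N nzN ->] uz e0 e1 e2.
have nzNM : \det (invmx N *m M) != 0 by rewrite det_mulmx mulf_neq0 ?det_invmx_neq0.
have NM : mob (invmx N *m M) = id.
  apply: (mob_fix3 nzNM uz); rewrite mobM //= ?e0 ?e1 ?e2; exact: mobK.
apply/funext => z; apply: (mob_inj (det_invmx_neq0 nzN)).
by rewrite mobK // -[RHS]/(id z) -NM mobM.
Qed.

Lemma lft_comp (f g : option C -> option C) :
  is_lft f -> is_lft g -> is_lft (f \o g).
Proof.
move=> /is_lft_mob[M nzM ->] /is_lft_mob[N nzN ->]; apply/is_lft_mob.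
by exists (M *m N); rewrite ?mobM // det_mulmx mulf_neq0.
Qed.

Lemma lft_inj (f : option C -> option C) : is_lft f -> injective f.
Proof. by move=> /is_lft_mob[M nzM ->]; apply: mob_inj. Qed.

Lemma lft_id : is_lft (id : option C -> option C).
Proof. by apply/is_lft_mob; exists 1%:M; rewrite ?mob1 // det1 oner_neq0. Qed.

End MobiusMatrices.

(** * The action on configurations and its cross-ratio formula *)

(** The image of [x] under the LFT that sends [a], [b], [e] to 0, 1, infinity. *)
Definition cr {F : fieldType} (x a b e : F) : F :=
  (x - a) * (b - e) / ((x - e) * (b - a)).

Section ConfigurationAction.
Context {R : realType} {d : nat}.
Local Notation C := R[i].
Implicit Types (l : 'rV[C]_d) (s t : 'S_(3 + d)) (c : C).

Definition base_index (j : nat) : 'I_(3 + d) := lshift d (inord j).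
Local Notation i0 := (base_index 0).
Local Notation i1 := (base_index 1).
Local Notation i2 := (base_index 2).

Lemma zpt_lshift l j : zpt l (lshift d j) = zero_one_oo j.
Proof. by rewrite /zpt (unsplitK (inl j)). Qed.

Lemma zpt_rshift l j : zpt l (rshift 3 j) = Some (l 0 j).
Proof. by rewrite /zpt (unsplitK (inr j)). Qed.

Lemma zpt0 l : zpt l i0 = Some 0.
Proof. by rewrite zpt_lshift /zero_one_oo inordK. Qed.

Lemma zpt1 l : zpt l i1 = Some 1.
Proof. by rewrite zpt_lshift /zero_one_oo inordK. Qed.

Lemma zpt2 l : zpt l i2 = None.
Proof. by rewrite zpt_lshift /zero_one_oo inordK. Qed.

Definition zptE := (zpt0, zpt1, zpt2, zpt_rshift).

Lemma ord3_cases (P : 'I_3 -> Prop) :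
  P (inord 0) -> P (inord 1) -> P (inord 2) -> forall j, P j.
Proof.
by move=> P0 P1 P2 j; rewrite -[j]inord_val; case: j => -[|[|[|]]].
Qed.

Lemma index_cases (P : 'I_(3 + d) -> Prop) :
  P i0 -> P i1 -> P i2 -> (forall j, P (rshift 3 j)) -> forall i, P i.
Proof.
move=> P0 P1 P2 Pr i; case: (split_ordP i) => j ->; last exact: Pr.
by move: j; apply: ord3_cases.
Qed.

(** This form of the definition treats all the points alike, and so makes the
    stability of [Kconf] under the action evident. *)
Lemma KconfP l : Kconf l <-> injective (zpt l).
Proof.
split=> [[nz l_inj] | z_inj].
  elim/index_cases => [|||i]; elim/index_cases => [|||j];
    rewrite !zptE // => -[] // /eqP;
    rewrite ?oner_eq0 ?(eq_sym 0) ?oner_eq0 ?(eq_sym 1) //.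
  - by rewrite (negPf (nz j).1).
  - by rewrite (negPf (nz j).2).
  - by rewrite (negPf (nz i).1).
  - by rewrite (negPf (nz i).2).
  - by move/eqP/l_inj->.
split=> [i|i j eq_l].
  split; apply/eqP => li.
    have /z_inj/eqP : zpt l (rshift 3 i) = zpt l i0 by rewrite !zptE li.
    by rewrite eq_shift.
  have /z_inj/eqP : zpt l (rshift 3 i) = zpt l i1 by rewrite !zptE li.
  by rewrite eq_shift.
by apply: (@rshift_inj 3 d); apply: z_inj; rewrite !zptE eq_l.
Qed.

Definition off_config c l := forall i, zpt l i != Some c.

Lemma off_config_ex l : exists c, off_config c l.
Proof.
(* The modulus of c exceeds that of every finite point. *)
pose c := 1 + \sum_i `|odflt 0 (zpt l i)|; exists c => i; apply/eqP => zi.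
have c_ge0 : 0 <= c by rewrite addr_ge0 ?ler01 ?sumr_ge0.
have : c = 1 + (c + \sum_(j | j != i) `|odflt 0 (zpt l j)|).
  by rewrite {1}/c (bigD1 i) //= zi /= (ger0_norm c_ge0).
move/eqP; rewrite addrCA -subr_eq0 opprD addrA subrr add0r oppr_eq0 gt_eqF //.
by rewrite ltr_wpDr ?ltr01 ?sumr_ge0.
Qed.

(** The LFT 1 / (z - c), which sends [c] to infinity. *)
Definition away_mx c : 'M[C]_2 := mx2 0 1 1 (- c).

Lemma det_away_mx c : \det (away_mx c) = -1.
Proof. by rewrite det_mx2 !mxE /= mul0r sub0r mulr1. Qed.

(** The image of the [i]-th point under the LFT 1 / (z - c): for a good choice
    of [c] all the points become finite. *)
Definition wpt c l i : C := if zpt l i is Some z then (z - c)^-1 else 0.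

Lemma mob_away c l i : off_config c l -> mob (away_mx c) (zpt l i) = Some (wpt c l i).
Proof.
move/(_ i); rewrite /wpt mob_mx2; case: (zpt l i) => [z|] /= zc.
  rewrite mul1r subr_eq0 ifN; last by apply: contraNneq zc => ->.
  by rewrite mul0r add0r div1r.
by rewrite oner_eq0 mul0r.
Qed.

Lemma wpt_inj c l : Kconf l -> off_config c l -> injective (wpt c l).
Proof.
move=> /KconfP z_inj off i j eq_w; apply: z_inj.
apply: (@mob_inj _ (away_mx c)); first by rewrite det_away_mx oppr_eq0 oner_eq0.
by rewrite !mob_away // eq_w.
Qed.

Definition cr_mx (a b e : C) : 'M[C]_2 :=
  mx2 (b - e) (- a * (b - e)) (b - a) (- e * (b - a)).

Lemma det_cr_mx a b e : \det (cr_mx a b e) = (b - e) * (b - a) * (a - e).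
Proof. by rewrite det_mx2 !mxE /=; ring. Qed.

Lemma mob_cr_mx a b e x : x != e -> b != a ->
  mob (cr_mx a b e) (Some x) = Some (cr x a b e).
Proof.
move=> xe ba; have nz : (b - a) * (x - e) != 0 by rewrite mulf_neq0 ?subr_eq0.
rewrite mob_mx2 /=.
have -> : (b - a) * x + - e * (b - a) = (b - a) * (x - e) by ring.
rewrite (negPf nz); congr Some; rewrite /cr; field.
by rewrite !subr_eq0 xe ba.
Qed.

Lemma mob_cr_mx_pole a b e : mob (cr_mx a b e) (Some e) = None.
Proof. by rewrite mob_mx2 /= (_ : _ + _ = 0) ?eqxx //; ring. Qed.

Lemma cr_base0 (a b e : C) : cr a a b e = 0.
Proof. by rewrite /cr subrr !mul0r. Qed.

Lemma cr_base1 (a b e : C) : b != a -> b != e -> cr b a b e = 1.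
Proof. by move=> ba be; rewrite /cr; field; rewrite !subr_eq0 ba be. Qed.

Lemma base_index_uniq : uniq [:: i0; i1; i2].
Proof. by rewrite /= !inE !eq_lshift -!val_eqE /= !inordK. Qed.

Lemma flft_unique l s f : Kconf l -> is_lft f ->
  (forall j, f (zpt l (s^-1%g (lshift d j))) = zero_one_oo j) -> flft l s = f.
Proof.
move=> Kl lftf fE; apply: get_unique => // g [lftg gE].
have uz : uniq [seq zpt l (s^-1%g i) | i <- [:: i0; i1; i2]].
  rewrite map_inj_uniq ?base_index_uniq // => i j.
  by move/(KconfP _).1 => /(_ Kl)/perm_inj.
by apply: (lft_uniq lftg lftf uz); rewrite gE fE.
Qed.

Section CrossRatioFormula.
Variables (l : 'rV[C]_d) (c : C) (s : 'S_(3 + d)).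
Hypotheses (Kl : Kconf l) (off : off_config c l).
Let w j := wpt c l (s^-1%g j).
Let f := mob (cr_mx (w i0) (w i1) (w i2)) \o mob (away_mx c).

Lemma wpt_perm_inj : injective w.
Proof. by move=> i j /(wpt_inj Kl off)/perm_inj. Qed.

Lemma wpt_base_neq : [/\ w i1 != w i0, w i0 != w i2 & w i1 != w i2].
Proof.
rewrite !(inj_eq wpt_perm_inj); have := base_index_uniq.
by rewrite /= !inE !negb_or eq_sym => /andP[/andP[-> ->] /andP[->]].
Qed.

Lemma is_lft_cr : is_lft f.
Proof.
have [n01 n02 n12] := wpt_base_neq; apply: lft_comp; apply/is_lft_mob.
  by exists (cr_mx (w i0) (w i1) (w i2)); rewrite ?det_cr_mx ?mulf_neq0 ?subr_eq0.
by exists (away_mx c); rewrite ?det_away_mx ?oppr_eq0 ?oner_eq0.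
Qed.

Lemma cr_base j : f (zpt l (s^-1%g (lshift d j))) = zero_one_oo j.
Proof.
have [n01 n02 n12] := wpt_base_neq.
move: j; elim/ord3_cases; rewrite /f /= mob_away //.
- by rewrite -/(w i0) mob_cr_mx // cr_base0 /zero_one_oo inordK.
- by rewrite -/(w i1) mob_cr_mx // cr_base1 /zero_one_oo ?inordK.
- by rewrite -/(w i2) mob_cr_mx_pole /zero_one_oo ?inordK.
Qed.

Lemma flft_cr : flft l s = f.
Proof. exact: flft_unique Kl is_lft_cr cr_base. Qed.

End CrossRatioFormula.

Lemma is_lft_flft l s : Kconf l -> is_lft (flft l s).
Proof.
move=> Kl; have [c off] := off_config_ex l.
by rewrite (flft_cr s Kl off); apply: is_lft_cr.
Qed.

Lemma flft_base l s j : Kconf l ->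
  flft l s (zpt l (s^-1%g (lshift d j))) = zero_one_oo j.
Proof.
move=> Kl; have [c off] := off_config_ex l.
by rewrite (flft_cr s Kl off); apply: cr_base.
Qed.

Lemma gmap_out l s : ~ Kconf l -> gmap s l = l.
Proof. by move=> nKl; rewrite /gmap ifN //; apply/negP => /set_mem. Qed.

(** The action moves all the points of the configuration, the three normalized
    ones included, by the same LFT. *)
Lemma zpt_gmap l s i : Kconf l -> zpt (gmap s l) i = flft l s (zpt l (s^-1%g i)).
Proof.
move=> Kl; case: (split_ordP i) => j ->; first by rewrite zpt_lshift flft_base.
rewrite zpt_rshift /gmap mem_set // mxE.
case e: flft => [z|] //=; move: e; rewrite -(zpt2 l) zpt_lshift -(flft_base s _ Kl).
move/(lft_inj (is_lft_flft s Kl)) => /((KconfP _).1 Kl)/perm_inj/esym/eqP.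
by rewrite eq_shift.
Qed.

Lemma Kconf_gmap l s : Kconf l -> Kconf (gmap s l).
Proof.
move=> Kl; apply/KconfP => i j; rewrite !zpt_gmap //.
by move/(lft_inj (is_lft_flft s Kl)) => /((KconfP _).1 Kl)/perm_inj.
Qed.

Lemma eq_zpt l l' : zpt l =1 zpt l' -> l = l'.
Proof.
move=> e; apply/rowP => j; have := e (rshift 3 j).
by rewrite !zpt_rshift => -[].
Qed.

(** Both sides apply one LFT with the same values at three points.  The
    product of permutations composes from left to right, hence the order. *)
Lemma gmapM s t : gmap t \o gmap s = gmap (s * t) :> ('rV[C]_d -> 'rV[C]_d).
Proof.
apply/funext => l /=; have [Kl|nKl] := pselect (Kconf l); last by rewrite !gmap_out.
have Kl' := Kconf_gmap s Kl.
have stE : flft (gmap s l) t \o flft l s = flft l (s * t)%g.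
  symmetry; apply: flft_unique => // [|j]; first by apply: lft_comp; apply: is_lft_flft.
  by rewrite /= invMg permM -zpt_gmap // flft_base.
by apply: eq_zpt => i; rewrite !zpt_gmap // -stE invMg permM.
Qed.

Lemma gmap1 : gmap 1 = id :> ('rV[C]_d -> 'rV[C]_d).
Proof.
apply/funext => l; have [Kl|nKl] := pselect (Kconf l); last by rewrite gmap_out.
apply: eq_zpt => i; rewrite zpt_gmap // (flft_unique Kl lft_id) ?invg1 ?perm1 // => j.
by rewrite perm1 zpt_lshift.
Qed.

Lemma gmap_fixP l s : Kconf l ->
  gmap s l = l <-> forall i, flft l s (zpt l i) = zpt l (s i).
Proof.
move=> Kl; split=> [gl i|fE].
  by rewrite -[in RHS]gl zpt_gmap // permK.
by apply: eq_zpt => i; rewrite zpt_gmap // fE permKV.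
Qed.

(** The LFT 1 / (z - c) followed by a cross-ratio has the values 0, 1, infinity
    required of [flft]. *)
Lemma gmap_coord l s c j : Kconf l -> off_config c l ->
  let w i := wpt c l (s^-1%g i) in
  gmap s l 0 j = cr (w (rshift 3 j)) (w i0) (w i1) (w i2).
Proof.
move=> Kl off w; apply: (@Some_inj _); rewrite -zpt_rshift zpt_gmap //.
have [n01 n02 n12] := wpt_base_neq s Kl off.
rewrite (flft_cr s Kl off) /= mob_away // mob_cr_mx //.
by rewrite (inj_eq (wpt_perm_inj Kl off)) eq_sym eq_shift.
Qed.

End ConfigurationAction.

(** * Differentiability tools *)

Section NearEqual.
Context {K : numFieldType} {V W : normedModType K}.

(** The defining condition of the differential bears on a neighborhood only. *)
Lemma near_eq_is_diff (f g : V -> W) x :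
  (\forall y \near x, f y = g y) -> differentiable g x ->
  differentiable f x /\ 'd f x = 'd g x :> (V -> W).
Proof.
move=> fg dg; have fx : f x = g x by exact: nbhs_singleton fg.
have fE : f \o shift x = cst (f x) + 'd g x +o_ 0 id.
  apply/eqaddoP => e e_gt0; have /eqaddoP/(_ e e_gt0) := diff_locally dg.
  have := fg; rewrite (near_shift 0) subr0 /= => fg0.
  move=> gE; near=> h; rewrite !fctE /= fx.
  have -> : f (h + x) = g (h + x) by near: h.
  by near: h.
have dfE : 'd f x = 'd g x :> (V -> W).
  by apply: diff_unique => //; exact: diff_continuous.
by split=> //; apply/diff_locallyP; rewrite dfE; split=> //; exact: diff_continuous.
Unshelve. all: by end_near. Qed.

End NearEqual.

Section RowMaps.
Context {K : numFieldType} {V : normedModType K} {n : nat}.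

Lemma differentiable_row (f : V -> 'rV[K]_n) x :
  (forall j, differentiable (fun y => f y 0 j) x) -> differentiable f x.
Proof.
move=> df; have -> : f = \sum_(j < n) (fun y => f y 0 j *: delta_mx 0 j).
  by apply/funext => y; rewrite fct_sumE -row_sum_delta.
by apply: differentiable_sum => j; apply: differentiableZl.
Qed.

Lemma diff_row (f : V -> 'rV[K]_n) x h j : differentiable f x ->
  ('d f x h) 0 j = 'd (fun y => f y 0 j) x h.
Proof.
move=> df; pose c := (fun M : 'rV[K]_n => M 0 j).
have c_lin : linear (c : 'rV[K]_n -> K) by move=> a u v; rewrite /c !mxE.
pose cM := GRing.isLinear.Build _ _ _ _ _ c_lin.
pose cL : {linear 'rV[K]_n -> K} := HB.pack c cM.
have dc : differentiable cL (f x) by exact: (differentiable_coord (f x) 0 j).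
have e : 'd (cL \o f) x = 'd cL (f x) \o 'd f x :> (V -> K) := diff_comp df dc.
transitivity ('d (cL \o f) x h) => //.
have cont_c : continuous cL by exact: coord_continuous.
by rewrite e /= (diff_lin (f x) cont_c).
Qed.
End RowMaps.

Section NearCoordinates.
Context {K : numFieldType} {n : nat}.
Implicit Types (l : 'rV[K]_n).

Lemma near_neq (f : 'rV[K]_n -> K) l :
  differentiable f l -> f l != 0 -> \forall l' \near l, f l' != 0.
Proof.
move=> df nz; have fc : f @ l --> f l by exact: differentiable_continuous.
exact: (cvgr_neq0 (f l) fc nz).
Qed.

Lemma near_coord_neq l i a : l 0 i != a -> \forall l' \near l, (l' : 'rV_n) 0 i != a.
Proof.
rewrite -subr_eq0 => nza.
have : \forall l' \near l, (l' : 'rV_n) 0 i - a != 0.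
  apply: (near_neq (f := fun l' => l' 0 i - a)) => //.
  by apply: differentiableB; [exact: differentiable_coord|exact: differentiable_cst].
by apply: filterS => l'; rewrite subr_eq0.
Qed.

Lemma near_coords_neq l a : (forall i, l 0 i != a) ->
  \forall l' \near l, forall i, (l' : 'rV_n) 0 i != a.
Proof.
move=> nla; exact: (@filter_forall _ _ (fun i (l' : 'rV_n) => l' 0 i != a)
  (nbhs l) _ (fun i => near_coord_neq (nla i))).
Qed.

Lemma near_coord2_neq l i j : l 0 i != l 0 j ->
  \forall l' \near l, (l' : 'rV_n) 0 i != (l' : 'rV_n) 0 j.
Proof.
rewrite -subr_eq0 => nza.
have : \forall l' \near l, (l' : 'rV_n) 0 i - (l' : 'rV_n) 0 j != 0.
  apply: (near_neq (f := fun l' => l' 0 i - l' 0 j)) => //.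
  by apply: differentiableB; exact: differentiable_coord.
by apply: filterS => l'; rewrite subr_eq0.
Qed.

Lemma near_coords_inj l : injective (l 0) ->
  \forall l' \near l, injective ((l' : 'rV_n) 0).
Proof.
move=> l_inj; have : \forall l' \near l, forall i j,
    i != j -> (l' : 'rV_n) 0 i != (l' : 'rV_n) 0 j.
  have near_ij i j : \forall l' \near l,
      i != j -> (l' : 'rV_n) 0 i != (l' : 'rV_n) 0 j.
    have [->|ij] := eqVneq i j; first by near=> l'.
    have : l 0 i != l 0 j by rewrite (inj_eq l_inj).
    by move/near_coord2_neq; apply: filterS => l' + _.
  have near_i i : \forall l' \near l,
      forall j, i != j -> (l' : 'rV_n) 0 i != (l' : 'rV_n) 0 j.
    exact: (@filter_forall _ _ _ (nbhs l) _ (near_ij i)).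
  exact: (@filter_forall _ _ _ (nbhs l) _ near_i).
apply: filterS => l' l'_inj i j; apply: contra_eq; exact: l'_inj.
Unshelve. all: by end_near. Qed.

Lemma is_diff_coord l j :
  is_diff l (fun l' : 'rV[K]_n => l' 0 j) (fun h => h 0 j).
Proof.
apply: DiffDef; first exact: differentiable_coord.
have did : differentiable (id : 'rV[K]_n -> 'rV[K]_n) l by [].
apply/funext => h; have := diff_row h j did.
by rewrite diff_val.
Qed.

Lemma is_diff_pole l j c : l 0 j != c ->
  is_diff l (fun l' : 'rV[K]_n => (l' 0 j - c)^-1)
            (fun h => - ((l 0 j - c)^-1) ^+ 2 * h 0 j).
Proof.
rewrite -subr_eq0 => nz.
have dc : is_diff l (fun l' : 'rV[K]_n => l' 0 j - c) (fun h => h 0 j).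
  have dk : is_diff l (cst c : 'rV[K]_n -> K) 0 by exact: is_diff_cst.
  apply: (is_diff_eq (is_diffB (is_diff_coord l j) dk)).
  by apply/funext => h; rewrite !fctE subr0.
apply: DiffDef; first by apply: differentiableV => //; exact: ex_diff.
rewrite diffV //; apply/funext => h /=.
by rewrite diff_val -exprVn.
Qed.

(** The differential of the cross-ratio, obtained by logarithmic
    differentiation. *)
Definition dcr (x a b e dx da db de : K) : K :=
  cr x a b e * ((dx - da) / (x - a) + (db - de) / (b - e)
                - (dx - de) / (x - e) - (db - da) / (b - a)).

Lemma is_diff_cr (V : normedModType K) (x a b e dx da db de : V -> K) v :
  x v != a v -> b v != e v -> x v != e v -> b v != a v ->
  is_diff v x dx -> is_diff v a da -> is_diff v b db -> is_diff v e de ->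
  is_diff v (fun u => cr (x u) (a u) (b u) (e u))
    (fun h => dcr (x v) (a v) (b v) (e v) (dx h) (da h) (db h) (de h)).
Proof.
move=> xa be xe ba dfx dfa dfb dfe.
have dfn : is_diff v ((x - a) * (b - e))
    ((x v - a v) *: (db - de) + (b v - e v) *: (dx - da)).
  exact: is_diffM.
have dfd : is_diff v ((x - e) * (b - a))
    ((x v - e v) *: (db - da) + (b v - a v) *: (dx - de)).
  exact: is_diffM.
have nzd : ((x - e) * (b - a)) v != 0 by rewrite /= mulf_neq0 ?subr_eq0.
have dfi : is_diff v (fun u => (((x - e) * (b - a)) u)^-1)
    (- (((x - e) * (b - a)) v) ^- 2 \*:
      ((x v - e v) *: (db - da) + (b v - a v) *: (dx - de))).
  by apply: DiffDef; [exact: differentiableV | rewrite diffV ?diff_val].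
apply: is_diff_eq.
apply/funext => h /=; rewrite /dcr /cr !fctE /= /GRing.scale /=; field.
by rewrite !subr_eq0 xa be xe ba.
Qed.
End NearCoordinates.

Section NearConfig.
Context {R : realType} {d : nat}.
Local Notation C := R[i].
Local Notation CF := (R[i] : numFieldType).
Implicit Types (l : 'rV[CF]_d) (c : C).

(** The conditions only say that finitely many numbers are distinct, so that the
    cross-ratio formula holds in a neighborhood. *)
Lemma near_Kconf l c : Kconf l -> off_config c l ->
  \forall l' \near l, Kconf l' /\ off_config c l'.
Proof.
move=> [nz l_inj] off.
have nc i : l 0 i != c.
  by have := off (rshift 3 i); rewrite zpt_rshift; apply: contraNneq => ->.
have near0 := @near_coords_neq CF d l 0 (fun i => (nz i).1).
have near1 := @near_coords_neq CF d l 1 (fun i => (nz i).2).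
have nearc := @near_coords_neq CF d l c nc.
have neari := @near_coords_inj CF d l l_inj.
near=> l'; split; first split.
- by move=> i; split; move: i; near: l'.
- by near: l'.
- move=> i; move: i; apply: (@index_cases d) => [|||j]; rewrite !zptE.
  + by have := off (base_index 0); rewrite zpt0.
  + by have := off (base_index 1); rewrite zpt1.
  + by [].
  + apply/negP => /eqP[] /eqP; apply/negP; move: j; near: l'; exact: nearc.
Unshelve. all: by end_near. Qed.
End NearConfig.

(** * The differential of the action *)

Section GmapDifferential.
Context {R : realType} {d : nat}.
Local Notation C := R[i].
Local Notation CF := (R[i] : numFieldType).
Local Notation i0 := (base_index (d := d) 0).
Local Notation i1 := (base_index (d := d) 1).
Local Notation i2 := (base_index (d := d) 2).
Implicit Types (l : 'rV[CF]_d) (c : C) (s : 'S_(3 + d)).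

(** The derivative of 1 / (z - c) is minus its square; the first three points
    do not move. *)
Definition dwpt c l (h : 'rV[C]_d) (i : 'I_(3 + d)) : C :=
  if fintype.split i is inr j then - wpt c l i ^+ 2 * h 0 j else 0.

Lemma is_diff_wpt l c i : off_config c l ->
  is_diff l (fun l' : 'rV[CF]_d => wpt c l' i : CF) (fun h => dwpt c l h i).
Proof.
move=> off; rewrite /dwpt; case: (split_ordP i) => j ->.
  have -> : (fun l' : 'rV[CF]_d => wpt c l' (lshift d j) : CF) =
            cst (wpt c l (lshift d j)).
    by apply/funext => l'; rewrite /wpt !zpt_lshift.
  exact: is_diff_cst.
have -> : (fun l' : 'rV[CF]_d => wpt c l' (rshift 3 j) : CF) =
          (fun l' => (l' 0 j - c)^-1).
  by apply/funext => l'; rewrite /wpt !zpt_rshift.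
rewrite /wpt zpt_rshift; apply: (@is_diff_pole CF).
by have := off (rshift 3 j); rewrite zpt_rshift; apply: contraNneq => ->.
Qed.

Lemma gmap_differential l c s : Kconf l -> off_config c l ->
  let w i := wpt c l (s^-1%g i) in
  let dw h i := dwpt c l h (s^-1%g i) in
  differentiable (gmap s : 'rV[CF]_d -> 'rV[CF]_d) l /\
  forall h j, ('d (gmap s : 'rV[CF]_d -> 'rV[CF]_d) l h) 0 j =
    dcr (w (rshift 3 j)) (w i0) (w i1) (w i2)
      (dw h (rshift 3 j)) (dw h i0) (dw h i1) (dw h i2) :> CF.
Proof.
move=> Kl off w dw.
pose F j (l' : 'rV[CF]_d) : CF := cr (wpt c l' (s^-1%g (rshift 3 j)))
  (wpt c l' (s^-1%g i0)) (wpt c l' (s^-1%g i1)) (wpt c l' (s^-1%g i2)).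
have w_inj : injective w by exact: wpt_perm_inj.
have dF j : is_diff l (F j) (fun h => dcr (w (rshift 3 j)) (w i0) (w i1) (w i2)
      (dw h (rshift 3 j)) (dw h i0) (dw h i1) (dw h i2)).
  have [n01 n02 n12] := wpt_base_neq s Kl off.
  have nr k : w (rshift 3 j) != w (lshift d k) by rewrite (inj_eq w_inj) eq_shift.
  by apply: is_diff_cr => //; first [exact: nr | exact: is_diff_wpt].
have near_gmap j : \forall l' \near l, (gmap s l' : 'rV[CF]_d) 0 j = F j l'.
  apply: filterS (near_Kconf Kl off) => l' [Kl' off'].
  exact: gmap_coord.
have df : differentiable (gmap s : 'rV[CF]_d -> 'rV[CF]_d) l.
  apply: differentiable_row => j.
  have dFj : differentiable (F j) l by have [] := dF j.
  exact: (near_eq_is_diff (near_gmap j) dFj).1.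
split=> // h j; rewrite diff_row //.
have dFj : differentiable (F j) l by have [] := dF j.
by rewrite (near_eq_is_diff (near_gmap j) dFj).2 (diff_val (is_diff_def := dF j)).
Qed.
End GmapDifferential.

Section TraceOfSection.
Variables (F : fieldType) (d k n : nat).
(** [A] is a projection of an [n]-dimensional space onto a quotient, with section
    [B]; [K] spans its kernel, with retraction [Q]; [L] is an endomorphism that
    preserves the kernel, on which it acts as [S].  The trace on the quotient is
    the trace on the whole space minus the trace on the kernel. *)
Lemma mxtrace_section (A : 'M[F]_(d, n)) (B : 'M[F]_(n, d)) (K : 'M[F]_(n, k))
    (Q : 'M[F]_(k, n)) (L : 'M[F]_n) (S : 'M[F]_k) (e : (d + k = n)%N) :
  A *m B = 1%:M -> A *m K = 0 -> Q *m B = 0 -> Q *m K = 1%:M ->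
  L *m K = K *m S -> \tr (A *m L *m B) = \tr L - \tr S.
Proof.
case: n / e A B K Q L => A B K Q L AB AK QB QK LK.
(* Both block matrices are square, so this one-sided inverse is two-sided. *)
have AQBK : col_mx A Q *m row_mx B K = 1%:M.
  by rewrite mul_col_row AB AK QB QK -scalar_mx_block.
have := mulmx1C AQBK; rewrite mul_row_col => BAKQ.
rewrite -mulmxA mxtrace_mulC -mulmxA (_ : B *m A = 1%:M - K *m Q); last first.
  by rewrite -BAKQ addrK.
rewrite mulmxBr mulmx1 raddfB /= mulmxA LK.
by rewrite -mulmxA mxtrace_mulC -mulmxA QK mulmx1.
Qed.
End TraceOfSection.

Section InvariantJacobian.
Context {F : numFieldType} {d : nat}.
Local Notation i0 := (base_index (d := d) 0).
Local Notation i1 := (base_index (d := d) 1).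
Local Notation i2 := (base_index (d := d) 2).
Implicit Types (w u : 'I_(3 + d) -> F).

(** The matrix of the differential of all the cross-ratios at the points [w]. *)
Definition dcr_mx w : 'M[F]_(d, 3 + d) := \matrix_(j, i)
  dcr (w (rshift 3 j)) (w i0) (w i1) (w i2)
      (i == rshift 3 j)%:R (i == i0)%:R (i == i1)%:R (i == i2)%:R.

Lemma dcr_sum (I : finType) (x a b e : F) (f : I -> F) (dx da db de : I -> F) :
  \sum_i dcr x a b e (dx i) (da i) (db i) (de i) * f i =
  dcr x a b e (\sum_i dx i * f i) (\sum_i da i * f i) (\sum_i db i * f i)
              (\sum_i de i * f i).
Proof.
rewrite /dcr -!sumrB !mulr_suml -big_split /= -!sumrB mulr_sumr.
by apply: eq_bigr => i _; ring.
Qed.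

Lemma sum_delta (I : finType) (i : I) (f : I -> F) :
  \sum_k (k == i)%:R * f k = f i.
Proof.
rewrite (bigD1 i) //= eqxx mul1r big1 ?addr0 // => k /negPf->.
by rewrite mul0r.
Qed.

Lemma dcr_mxE m w (u : 'M[F]_(3 + d, m)) j k : (dcr_mx w *m u) j k =
  dcr (w (rshift 3 j)) (w i0) (w i1) (w i2)
      (u (rshift 3 j) k) (u i0 k) (u i1 k) (u i2 k).
Proof.
rewrite mxE; under eq_bigr do rewrite mxE.
by rewrite dcr_sum !sum_delta.
Qed.

(** Cross-ratios are invariant under LFTs, so their differential kills the
    vector fields 1, w and w^2 of this lemma and of the next two. *)
Lemma dcr_const (x a b e y : F) : dcr x a b e y y y y = 0.
Proof. by rewrite /dcr !subrr !mul0r addr0 !subr0 mulr0. Qed.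

Lemma dcr_id (x a b e : F) : x != a -> b != e -> x != e -> b != a ->
  dcr x a b e x a b e = 0.
Proof. by move=> *; rewrite /dcr !divff ?subr_eq0 // addrK subrr mulr0. Qed.

Lemma dcr_sqr (x a b e : F) : x != a -> b != e -> x != e -> b != a ->
  dcr x a b e (x ^+ 2) (a ^+ 2) (b ^+ 2) (e ^+ 2) = 0.
Proof.
move=> xa be xe ba; rewrite /dcr; field.
by rewrite !subr_eq0 xa be xe ba.
Qed.

Section MobiusInvariance.
Variables (al be ga de : F).
Local Notation D := (al * de - be * ga).
Local Notation mu x := ((al * x + be) / (ga * x + de)).
Local Notation mu' x := (D / (ga * x + de) ^+ 2).
Hypothesis D0 : D != 0.

(** This is the difference formula behind the invariance of cross-ratios: each
    point occurs once in the numerator and once in the denominator. *)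
Lemma mobius_sub x y : ga * x + de != 0 -> ga * y + de != 0 ->
  mu x - mu y = D * (x - y) / ((ga * x + de) * (ga * y + de)).
Proof. by move=> nx ny; field; rewrite nx ny. Qed.

(** The correction terms depend on one point each and cancel in the cross-ratio. *)
Lemma dlog_mobius_sub x y dx dy :
  ga * x + de != 0 -> ga * y + de != 0 -> x != y ->
  (mu' x * dx - mu' y * dy) / (mu x - mu y) =
  (dx - dy) / (x - y) - ga * dx / (ga * x + de) - ga * dy / (ga * y + de).
Proof.
move=> nx ny nxy; rewrite mobius_sub //; move: D D0 => D' nD; field.
by rewrite nx ny nD subr_eq0 nxy.
Qed.

Lemma cr_mobius x a b e : ga * x + de != 0 -> ga * a + de != 0 ->
  ga * b + de != 0 -> ga * e + de != 0 -> x != e -> b != a ->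
  cr (mu x) (mu a) (mu b) (mu e) = cr x a b e.
Proof.
move=> nx na nb ne xe ba; rewrite /cr !mobius_sub //.
move: (ga * x + de) (ga * a + de) (ga * b + de) (ga * e + de) nx na nb ne.
move: D D0 => D' nD p q r t np nq nr nt; field.
by rewrite !subr_eq0 xe ba nD np nq nr nt.
Qed.

(** The differential of the invariance of the cross-ratio under an LFT; the
    tangent vectors are multiplied by the derivative of the LFT. *)
Lemma dcr_mobius x a b e dx da db de' : ga * x + de != 0 -> ga * a + de != 0 ->
  ga * b + de != 0 -> ga * e + de != 0 ->
  x != a -> b != e -> x != e -> b != a ->
  dcr (mu x) (mu a) (mu b) (mu e) (mu' x * dx) (mu' a * da) (mu' b * db) (mu' e * de')
  = dcr x a b e dx da db de'.
Proof.
move=> nx na nb ne xa be' xe ba.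
by rewrite /dcr cr_mobius // !dlog_mobius_sub //; congr (_ * _); ring.
Qed.

(** The action of the LFT on quadratic vector fields, in the basis 1, w, w^2. *)
Definition quad_push : 'M[F]_3 := D^-1 *: \matrix_(i < 3, j < 3)
  nth 0 (nth [::]
    [:: [:: al ^+ 2; - (al * be); be ^+ 2];
        [:: - (2 * al * ga); al * de + be * ga; - (2 * be * de)];
        [:: ga ^+ 2; - (ga * de); de ^+ 2]] i) j.

Lemma quad_pushE x (k : 'I_3) : ga * x + de != 0 ->
  mu' x * x ^+ k = \sum_(i < 3) mu x ^+ i * quad_push i k.
Proof.
move=> nx; rewrite !big_ord_recl big_ord0 !mxE /= addr0 /bump /=.
case: k => -[|[|[|//]]] ? /=; field; by rewrite nx D0.
Qed.

(** This is the trace of the adjoint representation. *)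
Lemma mxtrace_quad_push : \tr quad_push = (al + de) ^+ 2 / D - 1.
Proof.
rewrite /mxtrace !big_ord_recl big_ord0 !mxE /= addr0; field.
exact: D0.
Qed.

End MobiusInvariance.
End InvariantJacobian.

(** * The trace of the Jacobian *)

(** The denominators [N 1 0 * x + N 1 1] and [N 1 0 * y + N 1 1] at the two fixed
    points are the eigenvalues of the matrix: their sum is its trace and their
    product its determinant. *)
Lemma multiplier_sum2 (F : fieldType) (N : 'M[F]_2) (x y : F) :
  N 1 0 * (x + y) = N 0 0 - N 1 1 ->
  N 1 0 * x ^+ 2 + (N 1 1 - N 0 0) * x - N 0 1 = 0 ->
  N 1 0 * x + N 1 1 != 0 -> N 1 0 * y + N 1 1 != 0 ->
  let tr := N 0 0 + N 1 1 in
  let det := N 0 0 * N 1 1 - N 0 1 * N 1 0 in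
  det / (N 1 0 * x + N 1 1) ^+ 2 + det / (N 1 0 * y + N 1 1) ^+ 2 =
  tr ^+ 2 / det - 2.
Proof.
move: (N 0 0) (N 0 1) (N 1 0) (N 1 1) => a b c e /eqP.
rewrite eq_sym subr_eq => /eqP-> /eqP; rewrite subr_eq0 => /eqP <- nx ny /=.
have -> : (c * (x + y) + e) * e -
    (c * x ^+ 2 + (e - (c * (x + y) + e)) * x) * c = (c * x + e) * (c * y + e).
  by ring.
have -> : c * (x + y) + e + e = (c * x + e) + (c * y + e) by ring.
by move: (c * x + e) (c * y + e) nx ny => u v nu nv; field; rewrite nu nv.
Qed.

Section TraceFormula.
Context {R : realType} {d : nat}.
Local Notation C := R[i].
Local Notation CF := (R[i] : numFieldType).
Local Notation i0 := (base_index (d := d) 0).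
Local Notation i1 := (base_index (d := d) 1).
Local Notation i2 := (base_index (d := d) 2).
Variables (l : 'rV[CF]_d) (c : C) (M : 'M[C]_2) (s : 'S_(3 + d)).
Hypotheses (Kl : Kconf l) (off : off_config c l) (nzM : \det M != 0).
Hypothesis Ms : forall i, mob M (zpt l i) = zpt l (s i).
Let w : 'I_(3 + d) -> C := wpt c l.
Let p : 'S_(3 + d) := (s^-1)%g.
Let N : 'M[C]_2 := away_mx c *m M *m invmx (away_mx c).

Lemma det_away_neq0 : \det (away_mx c) != 0.
Proof. by rewrite det_away_mx oppr_eq0 oner_eq0. Qed.

Lemma det_conj : \det N = \det M.
Proof.
rewrite !det_mulmx det_inv mulrAC divff ?mul1r //.
exact: det_away_neq0.
Qed.

Lemma mxtrace_conj : \tr N = \tr M.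
Proof.
rewrite mxtrace_mulC mulmxA mulVmx ?mul1mx //.
exact/mob_unit/det_away_neq0.
Qed.

(** [N] is the matrix, in the coordinate 1 / (z - c), of the LFT that permutes
    the configuration. *)
Lemma mob_conj i : mob N (Some (w (p i))) = Some (w i).
Proof.
have nzT := det_away_neq0; have nzTV := det_invmx_neq0 nzT.
rewrite -!mob_away // mobM //= mobK // mobM //= Ms permKV.
by [].
Qed.

(* The derivative of the LFT of [N] at the point that it sends to [w i]. *)
Let D (i : 'I_(3 + d)) : C := \det N / (N 1 0 * w (p i) + N 1 1) ^+ 2.

Lemma conj_den i : N 1 0 * w (p i) + N 1 1 != 0.
Proof. by have := mob_conj i; rewrite /mob /=; case: eqP. Qed.

Lemma conj_val i :
  w i = (N 0 0 * w (p i) + N 0 1) / (N 1 0 * w (p i) + N 1 1).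
Proof. by have := mob_conj i; rewrite /mob /= (negPf (conj_den i)) => -[]. Qed.

Let A : 'M[C]_(d, 3 + d) := dcr_mx (F := CF) w.
Let B : 'M[C]_(3 + d, d) := \matrix_(i, k) dwpt c l (delta_mx 0 k) i.
Let L : 'M[C]_(3 + d) := \matrix_(i, k) (D i * (k == p i)%:R).
Let K : 'M[C]_(3 + d, 3) := \matrix_(i, k) w i ^+ k.
(* The rows of [Q] give the coefficients of the quadratic polynomial with
   prescribed values at the first three points. *)
Let Q : 'M[C]_(3, 3 + d) := row_mx (invmx (usubmx K)) 0.
Let S : 'M[C]_3 := quad_push (N 0 0) (N 0 1) (N 1 0) (N 1 1).

Lemma w_inj : injective w.
Proof. exact: wpt_inj. Qed.

Lemma w_base_neq : [/\ w i1 != w i0, w i0 != w i2 & w i1 != w i2].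
Proof. by have := wpt_base_neq 1 Kl off; rewrite invg1 !perm1. Qed.

Lemma w_rshift_neq j k : w (rshift 3 j) != w (lshift d k).
Proof. by rewrite (inj_eq w_inj) eq_shift. Qed.

Lemma pushforward_wptE i k : (L *m B) i k = D i * dwpt c l (delta_mx 0 k) (p i).
Proof.
rewrite mxE; under eq_bigr do rewrite !mxE -mulrA.
by rewrite -mulr_sumr (sum_delta (F := CF)).
Qed.

(** To first order, [gmap s] moves the points by [B], carries the tangent vectors
    along by the LFT, which is [L], and takes cross-ratios, which is [A]: the
    invariance of cross-ratios replaces the permuted points by the original
    ones. *)
Lemma jacobianE : ('J (gmap s : 'rV[CF]_d -> 'rV[CF]_d) l)^T = A *m L *m B.
Proof.
apply/matrixP => j k; rewrite [LHS]mxE [LHS]mxE (gmap_differential s Kl off).2.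
rewrite -mulmxA (dcr_mxE (F := CF)) !pushforward_wptE.
have w_perm_inj : injective (fun i => w (p i)) by move=> i1' i2' /w_inj/perm_inj.
have [n01 n02 n12] := wpt_base_neq s Kl off.
have nr m : w (p (rshift 3 j)) != w (p (lshift d m)).
  by rewrite (inj_eq w_perm_inj) eq_shift.
have nzN : N 0 0 * N 1 1 - N 0 1 * N 1 0 != 0 by rewrite -det_mx2 det_conj.
rewrite !(conj_val (rshift _ _)) !(conj_val (lshift _ _)) /D det_mx2.
by rewrite (dcr_mobius (F := CF) nzN) ?conj_den.
Qed.

(** This is the case of the trivial permutation, whose Jacobian is the identity. *)
Lemma dcr_mx_wpt : A *m B = 1%:M.
Proof.
apply/matrixP => j k; rewrite (dcr_mxE (F := CF)) !mxE.
have := (gmap_differential 1 Kl off).2 (delta_mx 0 k) j.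
rewrite invg1 !perm1 => <-; rewrite gmap1.
have -> : 'd (id : 'rV[CF]_d -> 'rV[CF]_d) l = id :> (_ -> _).
  by rewrite diff_val.
by rewrite mxE eqxx /= eq_sym.
Qed.

Lemma dcr_mx_quad : A *m K = 0.
Proof.
have [n01 n02 n12] := w_base_neq.
apply/matrixP => j k; rewrite (dcr_mxE (F := CF)) !mxE.
case: k => -[|[|[|//]]] ? /=.
- by rewrite !expr0 dcr_const.
- by rewrite !expr1 dcr_id // w_rshift_neq.
- by rewrite dcr_sqr // w_rshift_neq.
Qed.

(** A quadratic polynomial is determined by its values at three points. *)
Lemma quad_base_unit : usubmx K \in unitmx.
Proof.
rewrite unitmxE unitfE.
have -> : usubmx K = (Vandermonde 3 (\row_k w (lshift d k)))^T.
  by apply/matrixP => i k; rewrite !mxE.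
rewrite det_tr det_Vandermonde; apply/prodf_neq0 => i _.
apply/prodf_neq0 => k ik; rewrite !mxE subr_eq0 (inj_eq w_inj) eq_shift.
by rewrite -val_eqE gtn_eqF.
Qed.

Lemma lagrange_quad : Q *m K = 1%:M.
Proof.
rewrite -[K]vsubmxK mul_row_col mul0mx addr0.
by rewrite mulVmx ?quad_base_unit // vsubmxK quad_base_unit.
Qed.

Lemma lagrange_wpt : Q *m B = 0.
Proof.
have -> : B = col_mx 0 (dsubmx B).
  rewrite -[LHS]vsubmxK; congr col_mx; apply/matrixP => i k.
  by rewrite !mxE /dwpt (unsplitK (inl i)).
by rewrite mul_row_col mulmx0 mul0mx addr0.
Qed.

(** LFTs map quadratic vector fields to quadratic vector fields. *)
Lemma pushforward_quad : L *m K = K *m S.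
Proof.
apply/matrixP => i k; rewrite mxE; under eq_bigr do rewrite !mxE -mulrA.
rewrite -mulr_sumr (sum_delta (F := CF)) [RHS]mxE; under [RHS]eq_bigr do rewrite mxE.
by rewrite /D det_mx2 quad_pushE ?conj_den -?det_mx2 ?det_conj // -conj_val.
Qed.

Lemma mxtrace_pushforward : \tr L = \sum_(i | s i == i) D i.
Proof.
rewrite [RHS]big_mkcond; apply: eq_bigr => i _; rewrite mxE.
have -> : (i == p i) = (s i == i) by rewrite /p -(can2_eq (permK s) (permKV s)).
by case: eqP => _; rewrite ?mulr1 ?mulr0.
Qed.

(** The trace on the sum of the tangent lines comes from the fixed points; the
    quadratic vector fields are divided out. *)
Lemma mxtrace_Xrep : \tr (Xrep l (gmap s)) =
  \sum_(i | s i == i) D i - (\tr M ^+ 2 / \det M - 1).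
Proof.
rewrite -mxtrace_conj -det_conj mxtrace_mx2 det_mx2.
rewrite -mxtrace_quad_push; last by rewrite -det_mx2 det_conj.
rewrite -mxtrace_pushforward /Xrep jacobianE.
apply: (mxtrace_section (addnC d 3)) pushforward_quad.
- exact: dcr_mx_wpt.
- exact: dcr_mx_quad.
- exact: lagrange_wpt.
- exact: lagrange_quad.
Qed.

Lemma sum_multipliers i k : i != k -> s i = i -> s k = k ->
  D i + D k = \tr M ^+ 2 / \det M - 2.
Proof.
move=> ik si sk.
have fixp x : s x = x -> p x = x by move=> sx; rewrite -[in LHS]sx permK.
have [pi pk] := (fixp _ si, fixp _ sk).
have [fi fk] := (mob_conj i, mob_conj k).
have nzN : \det N != 0 by rewrite det_conj.
have [di dk] := (conj_den i, conj_den k).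
rewrite -mxtrace_conj -det_conj /D; rewrite pi pk in fi fk di dk *.
have wik : w i != w k by rewrite (inj_eq w_inj).
have e1 := mob_fix2_some nzN wik fi fk.
have e2 := mob_fix_some nzN fi.
by rewrite mxtrace_mx2 det_mx2; exact: multiplier_sum2 e1 e2 di dk.
Qed.

End TraceFormula.

(** * The trace from the fixed points, and the isotropy representation *)

Lemma jacobian_comp (K : numFieldType) m n k (f : 'rV[K]_m -> 'rV[K]_n)
    (g : 'rV[K]_n -> 'rV[K]_k) (x : 'rV[K]_m) :
  differentiable f x -> differentiable g (f x) ->
  'J (g \o f) x = 'J f x *m 'J g (f x).
Proof.
move=> df dg; apply/row_matrixP => i.
by rewrite row_mul !rowE !mul_rV_lin1 (diff_comp df dg).
Qed.

Lemma jacobian_id (K : numFieldType) m (x : 'rV[K]_m) :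
  'J (id : 'rV[K]_m -> 'rV[K]_m) x = 1%:M.
Proof.
apply/row_matrixP => i; rewrite !rowE mul_rV_lin1 mulmx1.
by rewrite diff_val.
Qed.

Section TraceByFixedPoints.
Context {R : realType} {d : nat}.
Local Notation C := R[i].
Variables (l : 'rV[C]_d) (M : 'M[C]_2) (s : 'S_(3 + d)).
Hypotheses (Kl : Kconf l) (nzM : \det M != 0).
Hypothesis Ms : forall i, mob M (zpt l i) = zpt l (s i).

Lemma mxtrace_Xrep_free : (forall i, s i != i) ->
  \tr (Xrep l (gmap s)) = 1 - \tr M ^+ 2 / \det M.
Proof.
move=> free_s; have [c off] := off_config_ex l.
rewrite (mxtrace_Xrep Kl off nzM Ms) big1 ?sub0r ?opprB // => i.
by rewrite (negPf (free_s i)).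
Qed.

(** The two multipliers are inverse to each other; up to the constant -1, their
    sum is the trace on quadratic vector fields and cancels against it. *)
Lemma mxtrace_Xrep_fix2 i k : i != k -> s i = i -> s k = k ->
  (forall j, s j = j -> j = i \/ j = k) -> \tr (Xrep l (gmap s)) = -1.
Proof.
move=> ik si sk fix_s; have [c off] := off_config_ex l.
rewrite (mxtrace_Xrep Kl off nzM Ms) (bigD1 i) ?si //=.
rewrite (bigD1 k) ?sk ?eqxx ?(eq_sym k) //=.
rewrite big1 ?addr0 => [|j /andP[/andP[/eqP/fix_s[->|->]]]]; rewrite ?eqxx //.
by rewrite (sum_multipliers Kl off nzM Ms ik si sk); ring.
Qed.

End TraceByFixedPoints.

Section StabilizerRepresentation.
Context {R : realType} {d : nat}.
Local Notation C := R[i].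
Local Notation CF := (R[i] : numFieldType).
Local Notation S4 := [set: 'S_4]%G.
Variables (l : 'rV[CF]_d) (Psi : ('rV[C]_d -> 'rV[C]_d) -> 'S_4).
Hypotheses (Kl : Kconf l) (hPsi : Gstab_isom l Psi).

Lemma Gstab_gmap s : gmap s l = l -> Gstab l (gmap s).
Proof. by move=> gl; split=> //; exists s. Qed.

Lemma Gstab_id : Gstab l id.
Proof. by rewrite -gmap1; apply: Gstab_gmap; rewrite gmap1. Qed.

Lemma Gstab_comp g h : Gstab l g -> Gstab l h -> Gstab l (g \o h).
Proof.
move=> [[s _ <-] gl] [[t _ <-] hl]; rewrite gmapM; apply: Gstab_gmap.
by rewrite -gmapM /= hl gl.
Qed.

Lemma Xrep_id : Xrep l id = 1%:M :> 'M[C]_d.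
Proof.
by rewrite /Xrep (@jacobian_id CF) trmx1.
Qed.

Lemma Xrep_comp g h : Gstab l g -> Gstab l h ->
  Xrep l (g \o h) = Xrep l g *m Xrep l h.
Proof.
move=> [[s _ <-] gl] [[t _ <-] hl]; have [c off] := off_config_ex l.
have ds := (gmap_differential s Kl off).1; have dt := (gmap_differential t Kl off).1.
rewrite /Xrep -trmx_mul; congr (_^T).
have ds' : differentiable (gmap s : 'rV[CF]_d -> 'rV[CF]_d)
    (gmap t l : 'rV[CF]_d) by rewrite hl.
by rewrite (jacobian_comp dt ds') hl.
Qed.

Lemma Psi_comp g h : Gstab l g -> Gstab l h -> Psi (g \o h) = (Psi g * Psi h)%g.
Proof. by case: hPsi => _; apply. Qed.

Lemma Psi_id : Psi id = 1%g.
Proof.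
by apply: (mulgI (Psi id)); rewrite mulg1 -Psi_comp //; exact: Gstab_id.
Qed.

(** The chain rule at the fixed point [l] makes [Xrep] multiplicative, and [Psi]
    transports it to the symmetric group. *)
Lemma stab_repr : exists rX : mx_representation C S4 d,
  forall g, Gstab l g -> rX (Psi g) = Xrep l g.
Proof.
have [[_ Psi_inj Psi_surj] _] := hPsi.
have ex_inv x : exists g, Gstab l g /\ Psi g = x.
  by have [g Gg <-] := Psi_surj x I; exists g.
pose inv x := projT1 (cid (ex_inv x)).
have [inv_stab invK] : (forall x, Gstab l (inv x)) /\ forall x, Psi (inv x) = x.
  by split=> x; have [] := projT2 (cid (ex_inv x)).
have PsiK g : Gstab l g -> inv (Psi g) = g.
  by move=> Gg; apply: Psi_inj; rewrite ?inE ?invK.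
have repr_inv : mx_repr S4 (fun x => Xrep l (inv x)).
  split=> [|x y _ _]; first by rewrite -Psi_id PsiK ?Xrep_id //; exact: Gstab_id.
  have <- : inv x \o inv y = inv (x * y)%g.
    have <- : Psi (inv x \o inv y) = (x * y)%g by rewrite Psi_comp ?invK.
    by rewrite PsiK //; exact: Gstab_comp.
  exact: Xrep_comp.
by exists (MxRepresentation repr_inv) => g Gg /=; rewrite PsiK.
Qed.
End StabilizerRepresentation.

(** * Conjugacy classes of permutations of four letters *)

Section SymmetricGroup4.
Local Notation S4 := [set: 'S_4]%G.
Implicit Types (x y u : 'S_4).

Lemma perm_of_uniq4 (a b c e : 'I_4) : uniq [:: a; b; c; e] ->
  exists u : 'S_4,
    [/\ u (inord 0) = a, u (inord 1) = b, u (inord 2) = c & u (inord 3) = e].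
Proof.
move=> ut; have f_inj : injective (fun k : 'I_4 => nth a [:: a; b; c; e] k).
  by move=> i j /eqP; rewrite nth_uniq // => /eqP/val_inj.
by exists (perm f_inj); rewrite !permE /= !inordK.
Qed.

Lemma ord4_cases (P : 'I_4 -> Prop) :
  P (inord 0) -> P (inord 1) -> P (inord 2) -> P (inord 3) -> forall k, P k.
Proof. by move=> P0 P1 P2 P3 k; rewrite -[k]inord_val; case: k => -[|[|[|[|]]]]. Qed.

Lemma eq_inord4 i j : (i < 4)%N -> (j < 4)%N -> (inord i == inord j :> 'I_4) = (i == j).
Proof. by move=> ? ?; rewrite -val_eqE /= !inordK. Qed.

Lemma swap4_inord a b k : (a < 4)%N -> (b < 4)%N -> (k < 4)%N ->
  swap4 a b (inord k) = inord (if k == a then b else if k == b then a else k).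
Proof.
move=> a4 b4 k4; rewrite /swap4 permE /= !eq_inord4 //.
by case: eqP => // _; case: eqP.
Qed.

(** A permutation that acts on four letters [a k] as [c] acts on the labels [k] is
    conjugate to [c] by the relabeling. *)
Lemma class_of_frame x (c : 'S_4) (a : 'I_4 -> 'I_4) :
  uniq [:: a (inord 0); a (inord 1); a (inord 2); a (inord 3)] ->
  (forall k, x (a k) = a (c k)) -> x \in (c ^: S4)%g.
Proof.
move=> /perm_of_uniq4[u [u0 u1 u2 u3]] xa.
have uE k : u k = a k by move: k; apply: ord4_cases.
apply/imsetP; exists u; rewrite ?inE //; apply/permP => z.
by rewrite -[z](permKV u) permJ !uE xa.
Qed.

Lemma class_repr1 k : (k < 4)%N ->
  class_repr (inord 1) (inord k) = inord (nth 0 [:: 1; 2; 3; 0] k)%N.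
Proof.
move=> k4; rewrite /class_repr inordK //= !permM.
by case: k k4 => [|[|[|[|//]]]] _; rewrite !swap4_inord.
Qed.

Lemma class_repr2 k : (k < 4)%N ->
  class_repr (inord 2) (inord k) = inord (nth 0 [:: 1; 2; 0; 3] k)%N.
Proof.
move=> k4; rewrite /class_repr inordK //= !permM.
by case: k k4 => [|[|[|[|//]]]] _; rewrite !swap4_inord.
Qed.

Lemma class_repr3 k : (k < 4)%N ->
  class_repr (inord 3) (inord k) = inord (nth 0 [:: 1; 0; 3; 2] k)%N.
Proof.
move=> k4; rewrite /class_repr inordK //= !permM.
by case: k k4 => [|[|[|[|//]]]] _; rewrite !swap4_inord.
Qed.

Lemma class_repr4 k : (k < 4)%N ->
  class_repr (inord 4) (inord k) = inord (nth 0 [:: 1; 0; 2; 3] k)%N.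
Proof.
move=> k4; rewrite /class_repr inordK //=.
by case: k k4 => [|[|[|[|//]]]] _; rewrite !swap4_inord.
Qed.

Lemma perm_neq1 x : x != 1%g -> exists a, x a != a.
Proof.
move=> nx1; apply/existsP; apply: contraNT nx1 => /existsPn h.
by apply/eqP/permP => a; rewrite perm1; apply/eqP; rewrite -[_ == _]negbK.
Qed.

(** An element whose square moves [a] cycles through [a] and its three
    successors. *)
Lemma order4_class x : (x ^+ 4)%g = 1%g -> (x ^+ 2)%g != 1%g ->
  x \in (class_repr (inord 1) ^: S4)%g /\
  (x ^+ 2)%g \in (class_repr (inord 3) ^: S4)%g.
Proof.
move=> x4 /perm_neq1[a xxa].
have x4E b : x (x (x (x b))) = b.
  by have := congr1 (fun y : 'S_4 => y b) x4; rewrite /= !expgS expg0 !permM !perm1.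
rewrite expgS expg1 permM in xxa.
have xa : x a != a by apply: contraNneq xxa => e; rewrite !e.
have xxxa : x (x (x a)) != a.
  by apply: contraNneq xa => e; rewrite -[X in _ == X](x4E a) e.
split.
  apply: (class_of_frame (a := fun k => nth a [:: a; x a; x (x a); x (x (x a))] k)).
    rewrite /= !inordK //= !inE !negb_or !(inj_eq (@perm_inj _ x)).
    by rewrite ![a == _]eq_sym xa xxa xxxa.
  apply: ord4_cases; rewrite class_repr1 //= !inordK //=; exact: x4E.
apply: (class_of_frame (a := fun k => nth a [:: a; x (x a); x a; x (x (x a))] k)).
  rewrite /= !inordK //= !inE !negb_or !(inj_eq (@perm_inj _ x)).
  by rewrite ![a == _]eq_sym xa xxa xxxa.
apply: ord4_cases; rewrite class_repr3 //= expgS expg1 permM !inordK //=.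
all: exact: x4E.
Qed.

Lemma fourth_point (a b c : 'I_4) : uniq [:: a; b; c] ->
  exists e, uniq [:: a; b; c; e].
Proof.
move=> ut; have [e he] : exists e, e \notin [:: a; b; c].
  apply/existsP; apply: contraT => /existsPn h.
  have : (#|'I_4| <= size [:: a; b; c])%N.
    rewrite -(card_uniqP ut); apply/subset_leq_card/fintype.subsetP => z _.
    by have := h z; rewrite negbK.
  by rewrite card_ord.
exists e; rewrite -[X in uniq X]/(rcons [:: a; b; c] e) rcons_uniq ut andbT.
exact: he.
Qed.

Lemma in_uniq4 (a b c e : 'I_4) z : uniq [:: a; b; c; e] -> z \in [:: a; b; c; e].
Proof.
move=> ut; apply: contraT => nz; have : uniq (z :: [:: a; b; c; e]) by rewrite /= nz.
move/card_uniqP => /= e5; have := max_card (mem (z :: [:: a; b; c; e])).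
by rewrite e5 card_ord.
Qed.

(** The orbit of a moved letter has three elements, so the fourth letter is
    fixed. *)
Lemma order3_class x : (x ^+ 3)%g = 1%g -> x != 1%g ->
  x \in (class_repr (inord 2) ^: S4)%g.
Proof.
move=> x3 /perm_neq1[a xa].
have x3E b : x (x (x b)) = b.
  by have := congr1 (fun y : 'S_4 => y b) x3; rewrite /= !expgS expg0 !permM !perm1.
have xxa : x (x a) != a.
  by apply: contraNneq xa => e; rewrite -[X in _ == X](x3E a) e.
have ut : uniq [:: a; x a; x (x a)].
  rewrite /= !inE !negb_or !(inj_eq (@perm_inj _ x)).
  by rewrite ![a == _]eq_sym xa xxa.
have [e ue] := fourth_point ut.
have xe : x e = e.
  have := in_uniq4 (x e) ue; rewrite !inE.
  rewrite -[X in x e == X](x3E a) !(inj_eq (@perm_inj _ x)).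
  move: ue; rewrite /= !inE !negb_or ![_ == e]eq_sym.
  by case/and4P=> /and3P[_ _ /negPf->] /andP[_ /negPf->] /negPf-> _ /= /eqP.
apply: (class_of_frame (a := fun k => nth a [:: a; x a; x (x a); e] k)).
  by rewrite !inordK.
by apply: ord4_cases; rewrite class_repr2 //= !inordK //= x3E.
Qed.

Lemma class_repr3_even : odd_perm (class_repr (inord 3)) = false.
Proof. by rewrite /class_repr inordK //= odd_permM !odd_tperm !eq_inord4. Qed.

Lemma class_repr1_odd : odd_perm (class_repr (inord 1)).
Proof. by rewrite /class_repr inordK //= !odd_permM !odd_tperm !eq_inord4. Qed.

Lemma odd_class x c : x \in (c ^: S4)%g -> odd_perm x = odd_perm c.
Proof. by case/imsetP=> u _ ->; rewrite odd_permJ. Qed.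

(** If an involution that exchanges two letters also exchanged the other two, it
    would be even. *)
Lemma odd_involution_class x : (x ^+ 2)%g = 1%g -> odd_perm x ->
  x \in (class_repr (inord 4) ^: S4)%g.
Proof.
move=> x2 odd_x; have [a xa] : exists a, x a != a.
  by apply: perm_neq1; apply: contraTneq odd_x => ->; rewrite odd_perm1.
have x2E b : x (x b) = b.
  by have := congr1 (fun y : 'S_4 => y b) x2; rewrite /= !expgS expg0 !permM !perm1.
have [c nc] : exists c, c \notin [:: a; x a].
  apply/existsP; apply: contraT => /existsPn h.
  have : (#|'I_4| <= size [:: a; x a])%N.
    apply: leq_trans (card_size _); apply/subset_leq_card/fintype.subsetP => z _.
    by have := h z; rewrite negbK.
  by rewrite card_ord.
move: nc; rewrite !inE negb_or => /andP[ca cxa].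
have [e ue] : exists e, uniq [:: a; x a; c; e].
  apply: fourth_point; rewrite /= !inE !negb_or ![_ == c]eq_sym [a == _]eq_sym.
  by rewrite xa ca cxa.
have xc : x c \in [:: c; e].
  have := in_uniq4 (x c) ue; rewrite !inE.
  rewrite -[X in x c == X](x2E a) !(inj_eq (@perm_inj _ x)).
  by rewrite (negPf cxa) (negPf ca).
have xce : x c = c.
  move: xc; rewrite !inE => /orP[/eqP//|/eqP xc].
  have : x \in (class_repr (inord 3) ^: S4)%g.
    apply: (class_of_frame (a := fun k => nth a [:: a; x a; c; e] k)).
      by rewrite !inordK.
    by apply: ord4_cases; rewrite class_repr3 //= !inordK //= -?xc x2E.
  by move/odd_class; rewrite odd_x class_repr3_even.
have xe : x e = e.
  have := in_uniq4 (x e) ue; rewrite !inE.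
  rewrite -[X in x e == X](x2E a) !(inj_eq (@perm_inj _ x)) -[X in x e == X]xce.
  rewrite !(inj_eq (@perm_inj _ x)).
  move: ue; rewrite /= !inE !negb_or ![_ == e]eq_sym.
  by case/and4P=> /and3P[_ _ /negPf->] /andP[_ /negPf->] /negPf-> _ /= /eqP.
apply: (class_of_frame (a := fun k => nth a [:: a; x a; c; e] k)).
  by rewrite !inordK.
by apply: ord4_cases; rewrite class_repr4 //= !inordK //= x2E.
Qed.
End SymmetricGroup4.

(** * The rotation group of the cube *)

Section Cube.
Context {R : realType}.
Local Notation C := R[i].
Local Notation point := 'rV[R]_3.
Implicit Types (u v c a : point) (A B : 'M[R]_3).

Lemma sum_ord3 (f : 'I_3 -> R) : \sum_i f i = f (inord 0) + f (inord 1) + f (inord 2).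
Proof.
rewrite !big_ord_recl big_ord0 addr0 addrA.
by congr (f _ + f _ + f _); apply/val_inj; rewrite /= inordK.
Qed.

Definition sqnorm v : R := \sum_i v 0 i ^+ 2.

Lemma sqnormE v : sqnorm v = (v *m v^T) 0 0.
Proof. by rewrite mxE; apply: eq_bigr => i _; rewrite mxE expr2. Qed.

Lemma sqnorm_ge0 v : 0 <= sqnorm v.
Proof. by apply: sumr_ge0 => i _; exact: sqr_ge0. Qed.

Lemma norm2E v : norm2 v = Num.sqrt (sqnorm v). Proof. by []. Qed.

Lemma sphere2E v : sphere2 v <-> sqnorm v = 1.
Proof.
rewrite /sphere2 /= norm2E; split=> [e|->]; last by rewrite sqrtr1.
by rewrite -(sqr_sqrtr (sqnorm_ge0 v)) e expr1n.
Qed.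

Lemma sqnorm_orth A v : A *m A^T = 1%:M -> sqnorm (v *m A) = sqnorm v.
Proof. by move=> AA; rewrite !sqnormE trmx_mul mulmxA -(mulmxA v) AA mulmx1. Qed.

Lemma norm2_orth A v : A *m A^T = 1%:M -> norm2 (v *m A) = norm2 v.
Proof. by move=> AA; rewrite !norm2E sqnorm_orth. Qed.

Lemma radial_orth A v : A *m A^T = 1%:M -> radial v *m A = radial (v *m A).
Proof. by move=> AA; rewrite /radial norm2_orth // scalemxAl. Qed.

Lemma radialN v : radial (- v) = - radial v.
Proof.
rewrite /radial /norm2; under eq_bigr do rewrite mxE sqrrN.
by rewrite scalerN.
Qed.

Definition cubic c : Prop := forall i, c 0 i \in [:: -1; 0; 1].

Definition nnz v : nat := #|[set i | v 0 i != 0]%SET|.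

Lemma cubic_sqr c i : cubic c -> c 0 i ^+ 2 = (c 0 i != 0)%:R.
Proof.
move/(_ i); rewrite !inE => /or3P[] /eqP->.
- by rewrite sqrrN expr1n oppr_eq0 oner_eq0.
- by rewrite expr0n eqxx.
- by rewrite expr1n oner_eq0.
Qed.

(** The squared norm of such a vector counts its nonzero coordinates, so that
    orthogonal maps between such vectors preserve that number. *)
Lemma cubic_sqnorm c : cubic c -> sqnorm c = (nnz c)%:R.
Proof.
move=> cc; rewrite /nnz -sum1dep_card natr_sum /sqnorm [RHS]big_mkcond.
by apply: eq_bigr => i _; rewrite cubic_sqr //; case: (_ != 0).
Qed.

Lemma cubicN c : cubic c -> cubic (- c).
Proof.
move=> cc i; have := cc i; rewrite mxE !inE !eqr_oppLR opprK oppr0.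
by case/or3P=> ->; rewrite ?orbT.
Qed.

Lemma nnzZ (k : R) v : k != 0 -> nnz (k *: v) = nnz v.
Proof.
move=> nk; rewrite /nnz; congr #|pred_of_set _|; apply/setP => i.
by rewrite !inE mxE mulf_eq0 (negPf nk).
Qed.

Lemma nnzN v : nnz (- v) = nnz v.
Proof. by rewrite -scaleN1r nnzZ // oppr_eq0 oner_eq0. Qed.

Lemma cubic_norm2_neq0 c : cubic c -> (0 < nnz c)%N -> norm2 c != 0.
Proof.
move=> cc c0; rewrite norm2E gt_eqF // sqrtr_gt0 cubic_sqnorm //.
by rewrite ltr0n.
Qed.

Lemma nnz_radial c : cubic c -> (0 < nnz c)%N -> nnz (radial c) = nnz c.
Proof. by move=> cc c0; rewrite nnzZ // invr_neq0 // cubic_norm2_neq0. Qed.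

Lemma radial_inj c c' : cubic c -> cubic c' -> (0 < nnz c)%N -> (0 < nnz c')%N ->
  radial c = radial c' -> c = c'.
Proof.
move=> cc cc' c0 c0' e; have := nnz_radial cc c0.
rewrite e nnz_radial // => en.
move: e; rewrite /radial !norm2E !cubic_sqnorm // en.
apply: scalerI; rewrite invr_eq0 gt_eqF // sqrtr_gt0 ltr0n -en //.
Qed.

Lemma sphere2_radial c : cubic c -> (0 < nnz c)%N -> sphere2 (radial c).
Proof.
move=> cc c0; apply/sphere2E; rewrite /radial /sqnorm.
under eq_bigr do rewrite mxE exprMn.
rewrite -mulr_sumr -/(sqnorm c) exprVn norm2E sqr_sqrtr ?sqnorm_ge0 // mulVf //.
by rewrite cubic_sqnorm // pnatr_eq0 -lt0n.
Qed.

Lemma cube_pointsE k v :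
  cube_points k v <-> exists c, [/\ cubic c, nnz c = k & v = radial c].
Proof.
by split=> [[c [cc nc] <-]|[c [cc nc ->]]]; exists c.
Qed.

Lemma rotO_sign A c : rotO A -> cubic c -> nnz c = 3 -> cubic (c *m A).
Proof.
move=> [AA dA VA] cc nc.
have : V_O (radial c *m A) by rewrite -VA; exists (radial c) => //; exists c.
rewrite radial_orth // => /cube_pointsE[c' [cc' nc']].
rewrite /radial norm2_orth // !norm2E !cubic_sqnorm // nc nc'.
move=> e; have -> : c *m A = c'; last exact: cc'.
by apply: (scalerI _ e); rewrite invr_eq0 gt_eqF // sqrtr_gt0 ltr0n.
Qed.

Lemma nnz_orth A c : A *m A^T = 1%:M -> cubic c -> cubic (c *m A) ->
  nnz (c *m A) = nnz c.
Proof.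
move=> AA cc cA; apply/eqP; rewrite -(eqr_nat R) -!cubic_sqnorm //.
by rewrite sqnorm_orth.
Qed.

Lemma nnz3P v : nnz v = 3 <-> forall i, v 0 i != 0.
Proof.
have e3 : #|[set: 'I_3]%SET| = 3 by rewrite cardsT card_ord.
rewrite /nnz; split=> [e i|nz].
  have /eqP/setP/(_ i) : [set i | v 0 i != 0]%SET == [set: 'I_3]%SET.
    by rewrite eqEcard finset.subsetT e3 e.
  by rewrite !inE.
by rewrite -e3; congr #|pred_of_set _|; apply/setP => i; rewrite !inE; exact: nz.
Qed.

(** The vector [c] is half the sum of two vertices of the cube, obtained by
    replacing its zeros by 1 and by -1.  Vertices are sent to vertices, so each
    coordinate of the image is half the sum of two signs. *)
Lemma rotO_cubic A c : rotO A -> cubic c -> cubic (c *m A).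
Proof.
move=> rA cc.
(* [f 1] and [f (-1)] are the two vertices. *)
pose f (e : R) : point := \row_i (if c 0 i == 0 then e else c 0 i).
have f_sign e : e \in [:: -1; 1] -> forall i, (f e *m A) 0 i \in [:: -1; 1].
  move=> he; have e0 : e != 0.
    by move: he; rewrite !inE => /orP[] /eqP->; rewrite ?oppr_eq0 oner_eq0.
  have cf : cubic (f e).
    move=> i; rewrite mxE; case: ifP => _; last exact: cc.
    by move: he; rewrite !inE => /orP[->|->]; rewrite ?orbT.
  have nf : nnz (f e) = 3.
    by apply/nnz3P => i; rewrite mxE; case: ifP => // /negbT.
  have cfA := rotO_sign rA cf nf; have [AA _ _] := rA.
  have nfA : nnz (f e *m A) = 3 by rewrite nnz_orth.
  move=> i; have := cfA i; have := (nnz3P _).1 nfA i.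
  by rewrite !inE => /negPf->.
have cE : c *m A = 2^-1 *: (f 1 *m A + f (-1) *m A).
  rewrite -mulmxDl scalemxAl; congr (_ *m _); apply/rowP => i; rewrite !mxE.
  by case: eqP => [->|_]; rewrite ?subrr ?mulr0 //; field.
move=> i; rewrite cE 2!mxE.
have h1 : (1 : R) \in [:: -1; 1] by rewrite !inE eqxx orbT.
have hN1 : (-1 : R) \in [:: -1; 1] by rewrite !inE eqxx.
have := f_sign _ hN1 i; have := f_sign _ h1 i; rewrite !inE.
move=> /orP[] /eqP-> /orP[] /eqP->; rewrite ?subrr ?addNr ?mulr0 ?eqxx ?orbT //.
- by rewrite -opprD mulrN mulVf ?eqxx // (_ : 1 + 1 = 2) ?pnatr_eq0.
- by rewrite mulVf ?eqxx ?orbT // (_ : 1 + 1 = 2) ?pnatr_eq0.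
Qed.

Lemma cube_points_rotO k A v : rotO A -> cube_points k v -> cube_points k (v *m A).
Proof.
move=> rA /cube_pointsE[c [cc nc ->]]; have [AA _ _] := rA.
apply/cube_pointsE; exists (c *m A); split; first exact: rotO_cubic.
  by rewrite nnz_orth //; exact: rotO_cubic.
by rewrite radial_orth.
Qed.

Lemma cubic_rotO A : A *m A^T = 1%:M -> \det A = 1 ->
  (forall c, cubic c -> cubic (c *m A)) ->
  (forall c, cubic c -> cubic (c *m A^T)) -> rotO A.
Proof.
move=> AA dA cA cAT; split=> //.
have AAT : A^T *m A^T^T = 1%:M by rewrite trmxK; exact: mulmx1C.
have pres B v : B *m B^T = 1%:M -> (forall c, cubic c -> cubic (c *m B)) ->
    V_O v -> V_O (v *m B).
  move=> BB cB /cube_pointsE[c [cc nc ->]]; apply/cube_pointsE.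
  exists (c *m B); split; [exact: cB | by rewrite nnz_orth //; exact: cB |].
  by rewrite radial_orth.
rewrite eqEsubset; split=> v /=; first by move=> [u Vu <-]; exact: pres.
move=> Vv; exists (v *m A^T); first exact: pres.
by rewrite -mulmxA (mulmx1C AA) mulmx1.
Qed.

Lemma rotOM A B : rotO A -> rotO B -> rotO (A *m B).
Proof.
move=> [AA dA VA] [BB dB VB]; split.
- by rewrite trmx_mul mulmxA -(mulmxA A) BB mulmx1.
- by rewrite det_mulmx dA dB mulr1.
- transitivity (mulmx^~ B @` (mulmx^~ A @` V_O)); last by rewrite VA VB.
  by rewrite image_comp; apply: eq_imagel => v _ /=; rewrite mulmxA.
Qed.

Lemma rotOV A : rotO A -> rotO A^T.
Proof.
move=> [AA dA VA]; split.
- by rewrite trmxK; exact: mulmx1C.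
- by rewrite det_tr.
- rewrite -{1}VA image_comp -[RHS]image_id; apply: eq_imagel => v _ /=.
  by rewrite -mulmxA AA mulmx1.
Qed.

Lemma rotO1 : rotO (1%:M : 'M[R]_3).
Proof.
split; rewrite ?det1 ?trmx1 ?mulmx1 //.
by rewrite -[RHS]image_id; apply: eq_imagel => v _ /=; rewrite mulmx1.
Qed.

Lemma sphere2_rotO A v : rotO A -> sphere2 v -> sphere2 (v *m A).
Proof. by move=> [AA _ _] /sphere2E e; apply/sphere2E; rewrite sqnorm_orth. Qed.

Lemma orbO_self a : orbO a a.
Proof. by exists 1%:M; [exact: rotO1 | rewrite mulmx1]. Qed.

Lemma orbO_rotO A a v : rotO A -> orbO a v -> orbO a (v *m A).
Proof.
by move=> rA [B rB <-]; exists (B *m A); [exact: rotOM | rewrite mulmxA].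
Qed.

Lemma orbO_sub a b v : orbO a v -> orbO b v -> orbO a `<=` orbO b.
Proof.
move=> [A rA <-] [B rB eB] _ [D rD <-]; exists (B *m A^T *m D).
  by apply: rotOM rD; apply: rotOM => //; exact: rotOV.
have [AA _ _] := rA.
by rewrite !mulmxA eB -(mulmxA a) AA mulmx1.
Qed.

Lemma orbO_cube k a v : cube_points k v -> orbO a v -> orbO a `<=` cube_points k.
Proof.
move=> kv av u au; have := orbO_sub av (orbO_self v) au.
by move=> [A rA <-]; exact: cube_points_rotO.
Qed.
End Cube.

(** * Stereographic images of rotations *)

Section StereographicRotations.
Context {R : realType}.
Local Notation C := R[i].
Local Notation point := 'rV[R]_3.
Implicit Types (u v c a : point) (A B : 'M[R]_3) (H : 'M[C]_2).

Local Notation "v .x" := (v 0 (inord 0)) (at level 2, format "v .x").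
Local Notation "v .y" := (v 0 (inord 1)) (at level 2, format "v .y").
Local Notation "v .z" := (v 0 (inord 2)) (at level 2, format "v .z").

Definition mk3 (x y z : R) : point := \row_j nth 0 [:: x; y; z] j.

Lemma mk3x x y z : (mk3 x y z).x = x. Proof. by rewrite mxE inordK. Qed.
Lemma mk3y x y z : (mk3 x y z).y = y. Proof. by rewrite mxE inordK. Qed.
Lemma mk3z x y z : (mk3 x y z).z = z. Proof. by rewrite mxE inordK. Qed.
Definition mk3E := (mk3x, mk3y, mk3z).

Lemma eq_point u v : u.x = v.x -> u.y = v.y -> u.z = v.z -> u = v.
Proof. by move=> ex ey ez; apply/rowP; apply: ord3_cases. Qed.

Lemma sphere_eq v : sphere2 v -> v.x ^+ 2 + v.y ^+ 2 + v.z ^+ 2 = 1.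
Proof. by move/sphere2E; rewrite /sqnorm sum_ord3. Qed.

Lemma sphere_pole v : sphere2 v -> v.z = 1 -> v.x = 0 /\ v.y = 0.
Proof.
move/sphere_eq => e z1; move/eqP: e; rewrite z1 expr1n -subr_eq0 addrK.
by rewrite paddr_eq0 ?sqr_ge0 // !sqrf_eq0 => /andP[/eqP-> /eqP->].
Qed.

(** The modulus of the image determines the height of the point. *)
Lemma stereo_inj u v : sphere2 u -> sphere2 v -> stereo u = stereo v -> u = v.
Proof.
move=> su sv; rewrite /stereo.
have [uz|uz] := eqVneq u.z 1; have [vz|vz] := eqVneq v.z 1 => //.
  move=> _; have [ux uy] := sphere_pole su uz; have [vx vy] := sphere_pole sv vz.
  by apply: eq_point; rewrite ?ux ?uy ?uz ?vx ?vy ?vz.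
case=> ex ey; have := sphere_eq su; have := sphere_eq sv.
have nu : 1 - u.z != 0 by rewrite subr_eq0 eq_sym.
have nv : 1 - v.z != 0 by rewrite subr_eq0 eq_sym.
have xE : u.x = v.x / (1 - v.z) * (1 - u.z) by rewrite -ex divfK.
have yE : u.y = v.y / (1 - v.z) * (1 - u.z) by rewrite -ey divfK.
move=> hv hu; have zE : u.z = v.z.
  move: hu; rewrite xE yE.
  have -> : (v.x / (1 - v.z) * (1 - u.z)) ^+ 2 + (v.y / (1 - v.z) * (1 - u.z)) ^+ 2
     = (v.x ^+ 2 + v.y ^+ 2) * (1 - u.z) ^+ 2 / (1 - v.z) ^+ 2 by field.
  have -> : v.x ^+ 2 + v.y ^+ 2 = (1 - v.z) * (1 + v.z).
    by rewrite -[v.x ^+ 2 + _](addrK (v.z ^+ 2)) hv; ring.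
  move=> hu; have : (1 - u.z) * ((1 + v.z) * (1 - u.z) - (1 - v.z) * (1 + u.z)) = 0.
    have -> : (1 - u.z) * ((1 + v.z) * (1 - u.z) - (1 - v.z) * (1 + u.z)) =
        (1 - v.z) * ((1 - v.z) * (1 + v.z) * (1 - u.z) ^+ 2 / (1 - v.z) ^+ 2 +
          u.z ^+ 2 - 1) by field.
    by rewrite hu subrr mulr0.
  move/eqP; rewrite mulf_eq0 (negPf nu) /= => /eqP e.
  apply/eqP; rewrite -subr_eq0; apply/eqP/(mulfI (x := 2)); first by rewrite pnatr_eq0.
  by rewrite mulr0 -[RHS]oppr0 -e; ring.
by apply: eq_point; rewrite ?xE ?yE ?zE // divfK.
Qed.

Definition intertwines H A := forall v, sphere2 v -> mob H (stereo v) = stereo (v *m A).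

(** The LFT of [H] is the stereographic image of the rotation [A] of the cube.  As
    matrices act on row vectors on the right, products are reversed. *)
Definition octahedral H A := [/\ \det H != 0, rotO A & intertwines H A].

Lemma octahedralM H H' A A' : octahedral H A -> octahedral H' A' ->
  octahedral (H' *m H) (A *m A').
Proof.
move=> [nH rA HA] [nH' rA' HA']; split.
- by rewrite det_mulmx mulf_neq0.
- exact: rotOM.
- by move=> v sv; rewrite mobM //= HA // HA' ?mulmxA //; exact: sphere2_rotO.
Qed.

Definition rot_z_mx : 'M[R]_3 := \matrix_(i < 3)
  nth 0 [:: mk3 0 1 0; mk3 (-1) 0 0; mk3 0 0 1] i.
Definition rot_y_mx : 'M[R]_3 := \matrix_(i < 3)
  nth 0 [:: mk3 0 0 1; mk3 0 1 0; mk3 (-1) 0 0] i.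

Lemma mul_rot_z v : v *m rot_z_mx = mk3 (- v.y) v.x v.z.
Proof.
apply: eq_point; rewrite !mxE sum_ord3 !mxE !inordK //= !mxE !inordK //=; ring.
Qed.

Lemma mul_rot_y v : v *m rot_y_mx = mk3 (- v.z) v.y v.x.
Proof.
apply: eq_point; rewrite !mxE sum_ord3 !mxE !inordK //= !mxE !inordK //=; ring.
Qed.

Lemma mul_rot_zT v : v *m rot_z_mx^T = mk3 v.y (- v.x) v.z.
Proof.
apply: eq_point; rewrite !mxE sum_ord3 !mxE !inordK //= !mxE !inordK //=; ring.
Qed.

Lemma mul_rot_yT v : v *m rot_y_mx^T = mk3 v.z v.y (- v.x).
Proof.
apply: eq_point; rewrite !mxE sum_ord3 !mxE !inordK //= !mxE !inordK //=; ring.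
Qed.

Lemma cubic_mk3 x y z : x \in [:: -1; 0; 1] -> y \in [:: -1; 0; 1] ->
  z \in [:: -1; 0; 1] -> cubic (mk3 x y z).
Proof. by move=> hx hy hz; apply: ord3_cases; rewrite mk3E. Qed.

Lemma unit_coordN (x : R) : x \in [:: -1; 0; 1] -> - x \in [:: -1; 0; 1].
Proof.
by rewrite !inE !eqr_oppLR opprK oppr0 => /or3P[] ->; rewrite ?orbT.
Qed.

Lemma eq_mulmx1 A : (forall v, v *m A = v) -> A = 1%:M.
Proof. by move=> vA; apply/row_matrixP => i; rewrite !rowE vA mulmx1. Qed.

Lemma rotO_rot_z : rotO rot_z_mx.
Proof.
apply: cubic_rotO.
- apply: eq_mulmx1 => v; rewrite mulmxA mul_rot_z mul_rot_zT.
  by apply: eq_point; rewrite !mk3E ?opprK.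
- rewrite (expand_det_row _ ord0) !big_ord_recl big_ord0 /cofactor !mxE /=.
  rewrite !(mul0r, addr0, add0r) (expand_det_row _ ord0) !big_ord_recl big_ord0.
  by rewrite /cofactor !det_mx11 !mxE /= /bump /=; ring.
- move=> c cc; rewrite mul_rot_z; apply: cubic_mk3; rewrite ?unit_coordN //; exact: cc.
- move=> c cc; rewrite mul_rot_zT; apply: cubic_mk3; rewrite ?unit_coordN //; exact: cc.
Qed.

Lemma rotO_rot_y : rotO rot_y_mx.
Proof.
apply: cubic_rotO.
- apply: eq_mulmx1 => v; rewrite mulmxA mul_rot_y mul_rot_yT.
  by apply: eq_point; rewrite !mk3E ?opprK.
- rewrite (expand_det_row _ ord0) !big_ord_recl big_ord0 /cofactor !mxE /=.
  rewrite !(mul0r, addr0, add0r) (expand_det_row _ ord0) !big_ord_recl big_ord0.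
  by rewrite /cofactor !det_mx11 !mxE /= /bump /=; ring.
- move=> c cc; rewrite mul_rot_y; apply: cubic_mk3; rewrite ?unit_coordN //; exact: cc.
- move=> c cc; rewrite mul_rot_yT; apply: cubic_mk3; rewrite ?unit_coordN //; exact: cc.
Qed.

Lemma intertwines_rot_z : intertwines (mx2 'i 0 0 1) rot_z_mx.
Proof.
move=> v sv; rewrite mul_rot_z /stereo !mk3E mob_mx2.
case: eqP => [_|/eqP vz] /=; first by rewrite eqxx.
rewrite !mul0r !add0r !addr0 oner_eq0 divr1; congr Some.
by apply/eqP; rewrite eq_complex /= !mul0r !mul1r sub0r add0r mulNr !eqxx.
Qed.

(** The quarter turn about the second axis fixes the points i and -i and sends 0
    to 1.  On the sphere, the claim reduces to the equation of the sphere. *)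
Lemma intertwines_rot_y : intertwines (mx2 1 1 (-1) 1) rot_y_mx.
Proof.
move=> v sv; rewrite mul_rot_y /stereo !mk3E.
case: eqP => [vz|/eqP vz].
  have [-> ->] := sphere_pole sv vz; rewrite vz mob_mx2 /= oppr_eq0 oner_eq0.
  rewrite [0 == 1]eq_sym oner_eq0 subr0 !divr1 invrN1 mul1r; congr Some.
  by apply/eqP; rewrite eq_complex /= oppr0 !eqxx.
have nz : 1 - v.z != 0 by rewrite subr_eq0 eq_sym.
have sv' := sphere_eq sv.
apply/mob_eq.
  by rewrite det_mx2 !mxE /= mulr1 mulrN1 opprK (_ : 1 + 1 = 2) ?pnatr_eq0.
rewrite !mxE /=; case: eqP => [vx|/eqP vx] /=.
  have [vy vz0] : v.y = 0 /\ v.z = 0.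
    move/eqP: sv'; rewrite vx expr1n -addrA addrC -subr_eq0 addrK.
    by rewrite paddr_eq0 ?sqr_ge0 // !sqrf_eq0 => /andP[/eqP-> /eqP->].
  apply/eqP; rewrite eq_complex /= vx vy vz0 subr0 !divr1.
  by apply/andP; split; apply/eqP; ring.
have nx : 1 - v.x != 0 by rewrite subr_eq0 eq_sym.
apply/eqP; rewrite eq_complex /=; apply/andP; split; rewrite -subr_eq0; apply/eqP.
  transitivity ((1 - (v.x ^+ 2 + v.y ^+ 2 + v.z ^+ 2)) / ((1 - v.z) * (1 - v.x))).
    by field; rewrite nx nz.
  by rewrite sv' subrr mul0r.
by field; rewrite nx nz.
Qed.

Definition rot_z : 'M[C]_2 := mx2 'i 0 0 1.
Definition rot_y : 'M[C]_2 := mx2 1 1 (-1) 1.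

Lemma octahedral_rot_z : octahedral rot_z rot_z_mx.
Proof.
split; [|exact: rotO_rot_z|exact: intertwines_rot_z].
by rewrite det_mx2 !mxE /= mulr1 mulr0 subr0 neq0Ci.
Qed.

Lemma octahedral_rot_y : octahedral rot_y rot_y_mx.
Proof.
split; [|exact: rotO_rot_y|exact: intertwines_rot_y].
by rewrite det_mx2 !mxE /= mulr1 mulrN1 opprK (_ : 1 + 1 = 2) ?pnatr_eq0.
Qed.

Lemma mx2M (a b c e a' b' c' e' : C) : mx2 a b c e *m mx2 a' b' c' e' =
  mx2 (a * a' + b * c') (a * b' + b * e') (c * a' + e * c') (c * b' + e * e').
Proof. by rewrite [LHS]mx2E !mulmx2 !mxE. Qed.

Lemma mob_scalar (k : C) : k != 0 -> mob (mx2 k 0 0 k) = id.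
Proof.
move=> nk; rewrite -mob1 -(mobZ 1%:M nk); congr mob; rewrite [RHS]mx2E.
by rewrite !mxE /= !mulr0 !mulr1.
Qed.

Lemma nnz_mk3 x y z : nnz (mk3 x y z) = ((x != 0%R) + (y != 0%R) + (z != 0%R))%N.
Proof.
rewrite /nnz -sum1dep_card big_mkcond !big_ord_recl big_ord0 !mxE /= addn0 addnA.
by do 3!case: (_ != 0).
Qed.

(** The vectors fixed by [A] form the line of [c], a vector that points to a face
    center, an edge midpoint or a vertex of the cube. *)
Definition axial H A c := [/\ octahedral H A, cubic c, (0 < nnz c)%N, c *m A = c &
  forall v, v *m A = v -> exists k, v = k *: c].

Lemma sphere_line (k : R) c : cubic c -> (0 < nnz c)%N -> sphere2 (k *: c) ->
  k *: c = radial c \/ k *: c = - radial c.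
Proof.
move=> cc c0 /sphere2E e; have nc := cubic_norm2_neq0 cc c0.
have : (k * norm2 c) ^+ 2 == 1.
  rewrite exprMn norm2E sqr_sqrtr ?sqnorm_ge0 // -{}e /sqnorm mulr_sumr.
  by apply/eqP; apply: eq_bigr => i _; rewrite mxE exprMn.
rewrite sqrf_eq1 /radial -scaleNr => /orP[] /eqP e1; [left|right]; congr (_ *: _).
  by rewrite -[LHS](mulfK nc) e1 mul1r.
by rewrite -[LHS](mulfK nc) e1 mulN1r.
Qed.

Lemma axial_fix H A c v : axial H A c -> sphere2 v ->
  v *m A = v <-> v = radial c \/ v = - radial c.
Proof.
move=> [[_ [AA _ _] _] cc c0 cA fixA] sv; split.
  by move=> /fixA[k e]; rewrite e in sv *; exact: sphere_line.
have rA : radial c *m A = radial c by rewrite radial_orth // cA.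
by case=> ->; rewrite ?mulNmx rA.
Qed.

Lemma radial_neqN c : cubic c -> (0 < nnz c)%N -> radial c != - radial c.
Proof.
move=> cc c0; apply/eqP => e; have /sphere2E := sphere2_radial cc c0.
have -> : radial c = 0.
  have : 2 *: radial c = 0 by rewrite scaler_nat mulr2n {1}e addNr.
  by move/eqP; rewrite scaler_eq0 pnatr_eq0 => /eqP.
by rewrite /sqnorm big1 => [/eqP|i _]; rewrite ?mxE ?expr0n // eq_sym oner_eq0.
Qed.

Lemma pm1_cubic (x : R) : x = 0 \/ x = 1 \/ x = -1 -> x \in [:: -1; 0; 1].
Proof. by case=> [->|[->|->]]; rewrite !inE !eqxx ?orbT. Qed.

Lemma eq_coord u v : u = v -> [/\ u.x = v.x, u.y = v.y & u.z = v.z].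
Proof. by move=> ->. Qed.

Lemma axial_quarter : axial rot_z rot_z_mx (mk3 0 0 1).
Proof.
split; first exact: octahedral_rot_z.
- by apply: cubic_mk3; apply: pm1_cubic; auto.
- by rewrite nnz_mk3 !eqxx oner_eq0.
- by rewrite mul_rot_z !mk3E oppr0.
- move=> v; rewrite mul_rot_z => /eq_coord[]; rewrite !mk3E => ex ey ez.
  by exists v.z; apply: eq_point; rewrite !mxE !inordK //=; lra.
Qed.

Definition half_turn : 'M[C]_2 := rot_z *m rot_z.

Lemma axial_half : axial half_turn (rot_z_mx *m rot_z_mx) (mk3 0 0 1).
Proof.
split; first exact: octahedralM octahedral_rot_z octahedral_rot_z.
- by apply: cubic_mk3; apply: pm1_cubic; auto.
- by rewrite nnz_mk3 !eqxx oner_eq0.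
- by rewrite mulmxA !mul_rot_z !mk3E oppr0.
- move=> v; rewrite mulmxA !mul_rot_z !mk3E => /eq_coord[]; rewrite !mk3E => ex ey ez.
  by exists v.z; apply: eq_point; rewrite !mxE !inordK //=; lra.
Qed.

Definition third_turn : 'M[C]_2 := rot_z *m rot_y.

Lemma axial_third : axial third_turn (rot_y_mx *m rot_z_mx) (mk3 1 (-1) 1).
Proof.
split; first exact: octahedralM octahedral_rot_y octahedral_rot_z.
- by apply: cubic_mk3; apply: pm1_cubic; auto.
- by rewrite nnz_mk3 !oppr_eq0 oner_eq0.
- by rewrite mulmxA !mul_rot_y !mul_rot_z !mk3E opprK.
- move=> v; rewrite mulmxA mul_rot_y mul_rot_z !mk3E => /eq_coord[].
  rewrite !mk3E => ex ey ez.
  by exists v.z; apply: eq_point; rewrite !mxE !inordK //=; lra.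
Qed.

(** The quarter turn about the first axis, conjugate to the one about the second
    by a quarter turn about the third; the last three factors are the inverse
    of that one. *)
Definition rot_x : 'M[C]_2 := rot_z *m (rot_y *m (rot_z *m (rot_z *m rot_z))).
Definition rot_x_mx : 'M[R]_3 :=
  rot_z_mx *m rot_z_mx *m rot_z_mx *m rot_y_mx *m rot_z_mx.

Lemma octahedral_rot_x : octahedral rot_x rot_x_mx.
Proof.
have Hz := octahedral_rot_z; have Hy := octahedral_rot_y.
by do 4![apply: octahedralM => //].
Qed.

Lemma mul_rot_x v : v *m rot_x_mx = mk3 v.x (- v.z) v.y.
Proof.
rewrite !mulmxA (mul_rot_z v) !(mul_rot_z (mk3 _ _ _), mul_rot_y (mk3 _ _ _), mk3E).
by apply: eq_point; rewrite !mk3E ?opprK.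
Qed.

(** The half turn about the first axis followed by a quarter turn about the third.
    As a quarter turn times a square, it has an odd image in the symmetric
    group. *)
Definition edge_turn : 'M[C]_2 := rot_z *m (rot_x *m rot_x).

Lemma axial_edge : axial edge_turn (rot_x_mx *m rot_x_mx *m rot_z_mx) (mk3 1 1 0).
Proof.
have Hx := octahedral_rot_x.
split; first by apply: octahedralM octahedral_rot_z; exact: octahedralM.
- by apply: cubic_mk3; apply: pm1_cubic; auto.
- by rewrite nnz_mk3 !oner_eq0.
- rewrite 2!mulmxA !(mul_rot_x (mk3 _ _ _), mul_rot_z (mk3 _ _ _), mk3E).
  by apply: eq_point; rewrite !mk3E; lra.
- move=> v; rewrite 2!mulmxA (mul_rot_x v).
  rewrite !(mul_rot_x (mk3 _ _ _), mul_rot_z (mk3 _ _ _), mk3E) => /eq_coord[].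
  rewrite !mk3E => ex ey ez.
  by exists v.x; apply: eq_point; rewrite !mxE !inordK //=; lra.
Qed.

Lemma eq_complex_parts (z w : C) : complex.Re z = complex.Re w ->
  complex.Im z = complex.Im w -> z = w.
Proof. by case: z w => [a b] [a' b'] /= -> ->. Qed.

Lemma mob_half2 : mob (half_turn *m half_turn) = id.
Proof.
rewrite /half_turn /rot_z !mx2M -[RHS](mob_scalar (oner_neq0 C)); congr mob.
by congr mx2; apply: eq_complex_parts => /=; ring.
Qed.

Lemma mob_third3 : mob (third_turn *m (third_turn *m third_turn)) = id.
Proof.
(* The cube of this matrix is 2 - 2i times the identity. *)
have nk : 2 +i* (-2) != 0 :> C by rewrite eq_complex /= pnatr_eq0.
rewrite /third_turn /rot_z /rot_y !mx2M -[RHS](mob_scalar nk); congr mob.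
by congr mx2; apply: eq_complex_parts => /=; ring.
Qed.

Lemma edge_turnE : edge_turn = mx2 0 ((-2) +i* 0) (0 +i* 2) 0.
Proof.
rewrite /edge_turn /rot_x /rot_z /rot_y !mx2M.
by congr mx2; apply: eq_complex_parts => /=; ring.
Qed.

Lemma mob_edge2 : mob (edge_turn *m edge_turn) = id.
Proof.
(* The square of this matrix is -4i times the identity. *)
have nk : 0 +i* (-4) != 0 :> C by rewrite eq_complex /= oppr_eq0 pnatr_eq0 andbF.
rewrite edge_turnE mx2M -[RHS](mob_scalar nk); congr mob.
by congr mx2; apply: eq_complex_parts => /=; ring.
Qed.

(** The trace of the LFT on quadratic vector fields. *)
Definition adj_trace (H : 'M[C]_2) : C := \tr H ^+ 2 / \det H - 1.

Lemma adj_trace_half : adj_trace half_turn = -1.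
Proof.
rewrite /adj_trace mxtrace_mx2 /half_turn /rot_z mx2M !mxE /= !mulr0 !addr0.
by rewrite mulr1 add0r -expr2 sqr_i addNr expr0n /= mul0r sub0r.
Qed.

Lemma adj_trace_edge : adj_trace edge_turn = -1.
Proof.
by rewrite /adj_trace mxtrace_mx2 edge_turnE !mxE /= addr0 expr0n /= mul0r sub0r.
Qed.

Lemma adj_trace_third : adj_trace third_turn = 0.
Proof.
rewrite /adj_trace mxtrace_mx2 det_mx2 /third_turn /rot_z /rot_y mx2M !mxE /=.
set t := _ ^+ 2; set e := _ - _ * _.
have eE : e = 0 +i* 2 by apply: eq_complex_parts => /=; ring.
have -> : t = e by rewrite eE; apply: eq_complex_parts => /=; ring.
by rewrite divff ?subrr // eE eq_complex /= pnatr_eq0 andbF.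
Qed.

Lemma adj_trace_quarter : adj_trace rot_z = 1.
Proof.
rewrite /adj_trace mxtrace_mx2 det_mx2 /rot_z !mxE /= mulr1 mulr0 subr0.
have -> : ('i + 1) ^+ 2 = (1 + 1) * 'i :> C.
  by apply: eq_complex_parts => /=; ring.
by rewrite mulfK ?neq0Ci // addrK.
Qed.

End StereographicRotations.

(** * Orbit sizes and the number of points *)

Section Counting.
Context {R : realType}.
Local Notation point := 'rV[R]_3.
Implicit Types (v c a : point) (P : pred nat).

(** [P] selects, among the face centers (1), the edge midpoints (2) and the
    vertices (3), the special orbits to be taken together. *)
Definition cubic_points P : set point :=
  [set v | exists c, [/\ cubic c, P (nnz c) & v = radial c]].

Definition unit_ints : seq int := [:: -1; 0; 1].
Definition cubes : seq (int * int * int) :=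
  [seq (xy, z) | xy <- [seq (x, y) | x <- unit_ints, y <- unit_ints], z <- unit_ints].
Definition vecz (t : int * int * int) : point := mk3 t.1.1%:~R t.1.2%:~R t.2%:~R.
Definition nzt (t : int * int * int) : nat :=
  ((t.1.1 != 0) + (t.1.2 != 0) + (t.2 != 0))%N.

Lemma nnz_vecz t : nnz (vecz t) = nzt t.
Proof. by rewrite nnz_mk3 !intr_eq0. Qed.

Lemma vecz_inj : injective vecz.
Proof.
move=> [[x y] z] [[x' y'] z'] /eq_coord[]; rewrite !mk3E /=.
by move=> /intr_inj-> /intr_inj-> /intr_inj->.
Qed.

Lemma unit_intsP (x : R) : x \in [:: -1; 0; 1] ->
  exists2 n, n \in unit_ints & x = n%:~R.
Proof.
by rewrite !inE => /or3P[] /eqP->; [exists (-1)|exists 0|exists 1].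
Qed.

Lemma cubic_vecz t : t \in cubes -> cubic (vecz t).
Proof.
case/allpairsP => -[xy z] [/allpairsP[[x y] [hx hy exy]] hz ->].
move: exy hx hy hz => /= -> hx hy hz.
have h (n : int) : n \in unit_ints -> (n%:~R : R) \in [:: -1; 0; 1].
  by rewrite !inE => /or3P[] /eqP->; rewrite ?eqxx ?orbT.
by apply: cubic_mk3; rewrite h.
Qed.

Lemma cubicP c : cubic c -> exists2 t, t \in cubes & c = vecz t.
Proof.
move=> cc; have [x hx ex] := unit_intsP (cc (inord 0)).
have [y hy ey] := unit_intsP (cc (inord 1)).
have [z hz ez] := unit_intsP (cc (inord 2)).
exists (x, y, z); last by apply: eq_point; rewrite mk3E.
by apply/allpairsP; exists ((x, y), z); split=> //; apply/allpairsP; exists (x, y).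
Qed.

Definition cubic_seq P : seq point := [seq radial (vecz t) | t <- cubes & P (nzt t)].

Lemma mem_cubic_seq P v : v \in cubic_seq P <-> cubic_points P v.
Proof.
split=> [/mapP[t]|[c [cc Pc ->]]].
  rewrite mem_filter => /andP[Pt ct] ->; exists (vecz t).
  by split; rewrite ?nnz_vecz //; exact: cubic_vecz.
have [t ct ce] := cubicP cc; apply/mapP; exists t; last by rewrite ce.
by rewrite mem_filter ct -nnz_vecz -ce Pc.
Qed.

Lemma uniq_cubic_seq P : ~~ P 0%N -> uniq (cubic_seq P).
Proof.
move=> P0; rewrite map_inj_in_uniq ?filter_uniq // => t t'.
rewrite !mem_filter => /andP[Pt ct] /andP[Pt' ct'].
have pos u : P (nzt u) -> (0 < nnz (vecz u))%N.
  by rewrite nnz_vecz lt0n; apply: contraTneq => ->.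
move/(radial_inj (cubic_vecz ct) (cubic_vecz ct') (pos _ Pt) (pos _ Pt')).
exact: vecz_inj.
Qed.

Lemma size_cubic_seq P : ~~ P 0%N ->
  size (cubic_seq P) = (6 * P 1 + 12 * P 2 + 8 * P 3)%N.
Proof.
move=> /negPf P0; rewrite size_map size_filter /cubes /= /nzt /= P0.
by case: (P 1); case: (P 2); case: (P 3).
Qed.

Lemma orbit_seq a : (orbO a #= `I_24)%card ->
  exists s : seq point, [/\ uniq s, size s = 24 & forall v, v \in s <-> orbO a v].
Proof.
move=> card_a; have /finite_fsetP[A eA] : finite_set (orbO a) by exists 24%N.
move: card_a; rewrite eA => /card_eq_fsetP sA; exists (finmap.enum_fset A).
by split=> //; exact: finmap.fset_uniq.
Qed.

(** The orbit of a face center, edge midpoint or vertex consists of points of the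
    same kind, of which there are at most 12. *)
Lemma orbO_not_cubic a P v : (orbO a #= `I_24)%card -> ~~ P 0%N ->
  orbO a v -> ~ cubic_points P v.
Proof.
move=> /orbit_seq[s [us ss sE]] P0 av [c [cc Pc ev]].
have sub : orbO a `<=` cube_points (nnz c).
  by apply: orbO_cube av; rewrite cube_pointsE; exists c.
have c0 : ~~ pred1 (nnz c) 0%N.
  by rewrite /= eq_sym; apply: contraNneq P0 => <-.
have : (size s <= size (cubic_seq (pred1 (nnz c))))%N.
  apply: uniq_leq_size us _ => u /sE/sub/cube_pointsE[c' [cc' nc' ->]].
  by apply/mem_cubic_seq; exists c'; split=> //=; rewrite nc'.
rewrite ss size_cubic_seq //=.
by case: eqP => [<-//|_]; case: eqP => [<-//|_]; case: eqP.
Qed.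

Definition octa_union P m (a : 'I_m -> point) : set point :=
  cubic_points P `|` \bigcup_k orbO (a k).

(** Distinct orbits are disjoint, and free orbits avoid the special ones, so the
    sizes add up. *)
Lemma octa_union_seq P m (a : 'I_m -> point) : ~~ P 0%N ->
  (forall k, sphere2 (a k) /\ (orbO (a k) #= `I_24)%card) ->
  injective (fun k => orbO (a k)) ->
  exists s : seq point, [/\ uniq s,
    size s = (6 * P 1 + 12 * P 2 + 8 * P 3 + 24 * m)%N &
    forall v, v \in s <-> octa_union P a v].
Proof.
move=> P0 ha a_inj.
have [orb orbP] := choice (fun k => orbit_seq (ha k).2).
pose g (x : 'I_m * 'I_24) : point := nth 0 (orb x.1) x.2.
have go x : orbO (a x.1) (g x).
  by have [uo so oE] := orbP x.1; apply/oE/mem_nth; rewrite so.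
have g_inj : injective g.
  move=> [k i] [k' i'] e; have kk : k = k'.
    apply: a_inj; have /= h := go (k, i); have /= h' := go (k', i'); rewrite e in h.
    by rewrite eqEsubset; split; [exact: orbO_sub h h'|exact: orbO_sub h' h].
  rewrite -kk in e *; congr (_, _); have [uo so oE] := orbP k.
  by move/eqP: e; rewrite /g /= nth_uniq ?so // => /eqP/val_inj.
exists (cubic_seq P ++ codom g); split.
- rewrite cat_uniq uniq_cubic_seq // codomE map_inj_uniq ?enum_uniq // andbT /=.
  apply/hasPn => v /mapP[x _ ->]; apply/negP => /mem_cubic_seq.
  exact: orbO_not_cubic (ha _).2 P0 (go x).
- by rewrite size_cat size_cubic_seq // size_codom card_prod !card_ord [(m * _)%N]mulnC.
- move=> v; rewrite mem_cat; split.
    case/orP => [/mem_cubic_seq|/codomP[x ->]]; first by left.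
    by right; exists x.1.
  case=> [/mem_cubic_seq->//|[k _ kv]]; apply/orP; right.
  have [uo so oE] := orbP k; have vo := (oE v).2 kv.
  have iv : (index v (orb k) < 24)%N by move: vo; rewrite -index_mem so.
  by apply/codomP; exists (k, Ordinal iv); rewrite /g /= nth_index.
Qed.
End Counting.

(** * Configurations with octahedral symmetry *)

(** The values of the character on the classes of [class_repr], in this order: the
    identity, quarter turns, third turns, half turns about face axes, and half
    turns about edge axes. *)
Definition octa_char (d : nat) (P : pred nat) (k : 'I_5) : int := nth 0
  [:: d%:Z; -1; if P 3%N then -1 else 0; if P 1%N then -1 else 1;
      if P 2%N then -1 else 1] k.

Section OctahedralConfigurations.
Context {R : realType} {d : nat}.
Local Notation C := R[i].
Local Notation point := 'rV[R]_3.
Local Notation S4 := [set: 'S_4]%G.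
Variables (l : 'rV[C]_d) (Psi : ('rV[C]_d -> 'rV[C]_d) -> 'S_4).
Variables (P : pred nat) (m : nat) (a : 'I_m -> point) (Phi : 'M[C]_2).
Hypotheses (Kl : Kconf l) (hPsi : Gstab_isom l Psi) (P0 : ~~ P 0%N).
Hypothesis ha : forall k, sphere2 (a k) /\ (orbO (a k) #= `I_24)%card.
Hypothesis a_inj : injective (fun k => orbO (a k)).
Hypothesis nzPhi : \det Phi != 0.
Let S := octa_union P a.
Hypothesis hS : mob Phi @` range (zpt l) = stereo @` S.

Lemma nnz_pos (c : point) : P (nnz c) -> (0 < nnz c)%N.
Proof. by move=> Pc; rewrite lt0n; apply: contraNneq P0 => <-. Qed.

Lemma octa_union_sphere v : S v -> sphere2 v.
Proof.
case=> [[c [cc Pc ->]]|[k _ [A rA <-]]].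
  by apply: sphere2_radial => //; exact: nnz_pos.
by apply: sphere2_rotO => //; case: (ha k).
Qed.

Lemma octa_union_rotO v A : rotO A -> S v -> S (v *m A).
Proof.
move=> rA [[c [cc Pc ->]]|[k _ kv]].
  left; have [AA _ _] := rA; have cA := rotO_cubic rA cc; exists (c *m A).
  by rewrite radial_orth // nnz_orth.
by right; exists k => //; exact: orbO_rotO.
Qed.

Lemma octa_union_radial c : cubic c -> (0 < nnz c)%N -> S (radial c) <-> P (nnz c).
Proof.
move=> cc c0; split=> [|Pc]; last by left; exists c.
case=> [[c' [cc' Pc' /(radial_inj cc cc' c0 (nnz_pos Pc')) ->]]//|[k _ kc]].
exfalso; apply: (orbO_not_cubic (P := predC1 0%N)) (ha k).2 _ kc _ => //.
by exists c; split=> //=; rewrite -lt0n.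
Qed.

(** Through the LFT and the stereographic projection, the indices of the points
    of the configuration are in bijection with the points of [S]. *)
Lemma config_points : exists V : 'I_(3 + d) -> point,
  [/\ forall i, mob Phi (zpt l i) = stereo (V i), forall i, S (V i), injective V &
      forall v, S v -> exists i, V i = v].
Proof.
have exV i : exists v, S v /\ stereo v = mob Phi (zpt l i).
  have : (stereo @` S) (mob Phi (zpt l i)).
    by rewrite -hS; exists (zpt l i) => //; exists i.
  by case=> v Sv <-; exists v.
have [V VP] := choice exV; exists V; split.
- by move=> i; have [_ ->] := VP i.
- by move=> i; have [] := VP i.
- move=> i j eV; have [_ ei] := VP i; have [_ ej] := VP j.
  apply: (((KconfP _).1 Kl)); apply: (mob_inj nzPhi).
  by rewrite -ei -ej eV.
- move=> v Sv; have : (mob Phi @` range (zpt l)) (stereo v) by rewrite hS; exists v.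
  case=> _ [i _ <-] ei; exists i; have [Si ei'] := VP i.
  apply: stereo_inj; [exact: octa_union_sphere|exact: octa_union_sphere|].
  by rewrite ei' ei.
Qed.

Variable V : 'I_(3 + d) -> point.
Hypotheses (VE : forall i, mob Phi (zpt l i) = stereo (V i)) (SV : forall i, S (V i)).
Hypotheses (V_inj : injective V) (V_onto : forall v, S v -> exists i, V i = v).

Lemma sphereV i : sphere2 (V i). Proof. exact: octa_union_sphere. Qed.

Lemma config_card : (3 + d = 6 * P 1 + 12 * P 2 + 8 * P 3 + 24 * m)%N.
Proof.
have [s [us <- sS]] := octa_union_seq P0 ha a_inj.
rewrite -(card_ord (3 + d)) -(size_codom V); apply: perm_size; apply: uniq_perm => //.
  by rewrite codomE map_inj_uniq ?enum_uniq.
move=> v; apply/idP/idP => [/codomP[i ->]|/sS/V_onto[i <-]].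
  exact: (sS _).2 (SV i).
exact: codom_f.
Qed.

(** The rotation [A] permutes the points of the configuration, and [x] is the
    image under [Psi] of the element of the stabilizer that it induces. *)
Definition config_sym H A x := octahedral H A /\
  exists s : 'S_(3 + d), (forall i, V (s i) = V i *m A) /\ Psi (gmap s) = x.

Lemma config_mob H A (s : 'S_(3 + d)) : octahedral H A ->
  (forall i, V (s i) = V i *m A) ->
  let M := invmx Phi *m H *m Phi in
  \det M != 0 /\ forall i, mob M (zpt l i) = zpt l (s i).
Proof.
move=> [nH rA HA] sA M; have nV := det_invmx_neq0 nzPhi.
split; first by rewrite !det_mulmx !mulf_neq0.
move=> i; rewrite /M mobM // mobM //= VE (HA _ (sphereV i)) -sA -VE.
exact: mobK.
Qed.

Lemma config_stab H A (s : 'S_(3 + d)) : octahedral H A ->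
  (forall i, V (s i) = V i *m A) -> gmap s l = l.
Proof.
move=> oH sA; have [nM Ms] := config_mob oH sA.
apply/(gmap_fixP s Kl) => i.
rewrite (flft_unique (s := s) Kl (f := mob (invmx Phi *m H *m Phi))) //.
  by apply/is_lft_mob; exists (invmx Phi *m H *m Phi).
by move=> j; rewrite Ms permKV zpt_lshift.
Qed.

Lemma config_sym_ex H A : octahedral H A -> exists x, config_sym H A x.
Proof.
move=> oH; have [nH rA HA] := oH.
have ex i : exists j, V j = V i *m A by apply: V_onto; exact: octa_union_rotO.
have [f fP] := choice ex.
have f_inj : injective f.
  move=> i j e; apply: V_inj; have := fP i; rewrite e fP => /(congr1 (mulmx^~ A^T)).
  by have [AA _ _] := rA; rewrite -!mulmxA AA !mulmx1.
exists (Psi (gmap (perm f_inj))); split=> //; exists (perm f_inj).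
by split=> // i; rewrite permE.
Qed.

Lemma config_symM H H' A A' x x' : config_sym H A x -> config_sym H' A' x' ->
  config_sym (H' *m H) (A *m A') (x' * x)%g.
Proof.
move=> [oH [s [sA <-]]] [oH' [s' [sA' <-]]]; split; first exact: octahedralM.
exists (s * s')%g; split=> [i|]; first by rewrite permM sA' sA mulmxA.
rewrite -gmapM; apply: hPsi.2; apply: Gstab_gmap.
  exact: config_stab oH' sA'.
exact: config_stab oH sA.
Qed.

Lemma config_sym1 H A x : mob H = id -> config_sym H A x -> x = 1%g.
Proof.
move=> H1 [[nH rA HA] [s [sA <-]]].
have -> : s = 1%g.
  apply/permP => i; rewrite perm1; apply: V_inj; rewrite sA.
  apply: stereo_inj; [exact: sphere2_rotO rA (sphereV i)|exact: sphereV|].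
  by rewrite -HA ?H1 //; exact: sphereV.
by rewrite gmap1; exact: Psi_id hPsi.
Qed.

Variable rX : mx_representation C S4 d.
Hypothesis rXE : forall g, Gstab l g -> rX (Psi g) = Xrep l g.

(** An index is fixed exactly when its point is an end of the axis.  The two ends
    are of the same kind, so they both belong to [S] or neither does. *)
Lemma config_sym_trace H A c x : axial H A c -> config_sym H A x ->
  \tr (rX x) = if P (nnz c) then -1 else - adj_trace H.
Proof.
move=> axH [oH [s [sA <-]]]; have [_ cc c0 _ _] := axH.
rewrite rXE; last by apply: Gstab_gmap; exact: config_stab oH sA.
have [nM Ms] := config_mob oH sA.
have fixE i : s i = i <-> V i = radial c \/ V i = - radial c.
  apply: iff_trans (axial_fix axH (sphereV i)); rewrite -sA.
  by split=> [->//|/V_inj].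
have ScN : S (- radial c) <-> P (nnz c).
  rewrite -radialN -(nnzN c); apply: octa_union_radial; rewrite ?nnzN //.
  exact: cubicN.
have Sc := octa_union_radial cc c0.
case: ifP => [Pc|/negP nPc].
  have [i ei] := V_onto (Sc.2 Pc); have [k ek] := V_onto (ScN.2 Pc).
  apply: (mxtrace_Xrep_fix2 Kl nM Ms (i := i) (k := k)).
  - by apply: contra_neq (radial_neqN cc c0) => ik; rewrite -ek -ik ei.
  - by apply/fixE; left.
  - by apply/fixE; right.
  - by move=> j /fixE[]; [rewrite -ei|rewrite -ek] => /V_inj; [left|right].
rewrite (mxtrace_Xrep_free Kl nM Ms) => [|i].
  rewrite /adj_trace opprB; congr (_ - _ / _).
    by rewrite mxtrace_mulC mulmxA mulmxV ?mob_unit // mul1mx.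
  by rewrite !det_mulmx det_inv mulrAC mulVf ?mul1r.
by apply/eqP => /fixE[] ei; apply: nPc; [apply/Sc|apply/ScN]; rewrite -ei; exact: SV.
Qed.

Lemma mxtrace_class x k : x \in (class_repr k ^: S4)%g ->
  \tr (rX (class_repr k)) = \tr (rX x).
Proof.
case/imsetP => y _ ->; rewrite conjgE !repr_mxM ?in_S4 // mxtrace_mulC.
by rewrite -mulmxA -repr_mxM ?in_S4 // mulgV repr_mx1 mulmx1.
Qed.

Hypothesis d2 : (2 <= d)%N.

(** The identity has trace [d], which is at least 2. *)
Lemma sym_neq1 H A c x : axial H A c -> config_sym H A x ->
  adj_trace H = -1 \/ adj_trace H = 0 -> x != 1%g.
Proof.
move=> axH sx hH; apply/eqP => x1; have := config_sym_trace axH sx.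
rewrite x1 repr_mx1 mxtrace1.
have dn (n : nat) : (n < 2)%N -> d%:R != n%:R :> C.
  by move=> n2; rewrite eqr_nat; apply: contraTneq d2 => ->; rewrite -ltnNge.
have d1 : d%:R != -1 :> C.
  by rewrite -subr_eq0 opprK natr1 pnatr_eq0.
case: ifP => _; first by move/eqP; rewrite (negPf d1).
case: hH => ->; rewrite ?opprK ?oppr0 => /eqP.
  by rewrite (negPf (dn 1%N isT)).
by rewrite (negPf (dn 0%N isT)).
Qed.

(** The orders of the rotations in the sphere give upper bounds for the orders of
    their images under [Psi], and [sym_neq1] excludes the smaller ones.  Only the
    half turn about an edge axis needs parity as well, to tell a transposition
    from a product of two. *)
Lemma octa_charE k : \tr (rX (class_repr k)) = (octa_char d P k)%:~R.
Proof.
(* All the elements below are products of these two. *)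
have [z sz] := config_sym_ex octahedral_rot_z.
have [y sy] := config_sym_ex octahedral_rot_y.
have szz := config_symM sz sz.
have sx := config_symM (config_symM (config_symM (config_symM sz sz) sz) sy) sz.
have se := config_symM (config_symM sx sx) sz; have st := config_symM sy sz.
move: sx se; set x := (z * _)%g => sx se.
have z2_neq1 := sym_neq1 axial_half szz (or_introl adj_trace_half).
have t_neq1 := sym_neq1 axial_third st (or_intror adj_trace_third).
have z4 : (z ^+ 4)%g = 1%g.
  rewrite !expgS expg0 mulg1 mulgA.
  exact: config_sym1 mob_half2 (config_symM szz szz).
have t3 : ((z * y) ^+ 3)%g = 1%g.
  rewrite !expgS expg0 mulg1.
  exact: config_sym1 mob_third3 (config_symM (config_symM st st) st).
have e2 : ((z * (x * x)) ^+ 2)%g = 1%g.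
  by rewrite !expgS expg0 mulg1; exact: config_sym1 mob_edge2 (config_symM se se).
have [] := order4_class z4; first by rewrite !expgS expg0 mulg1.
rewrite !expgS expg0 !mulg1 => z_class zz_class.
have e_class : (z * (x * x))%g \in (class_repr (inord 4) ^: S4)%g.
  apply: odd_involution_class e2 _.
  by rewrite !odd_permM addbb addbF (odd_class z_class) class_repr1_odd.
have t_class := order3_class t3 t_neq1.
rewrite -[k]inord_val; case: k => -[|[|[|[|[|//]]]]] ? /=.
- by rewrite /octa_char /class_repr !inordK //= repr_mx1 mxtrace1.
- rewrite (mxtrace_class z_class) (config_sym_trace axial_quarter sz).
  by rewrite adj_trace_quarter /octa_char inordK //=; case: ifP.
- rewrite (mxtrace_class t_class) (config_sym_trace axial_third st) adj_trace_third.
  rewrite nnz_mk3 !oppr_eq0 oner_eq0 /octa_char inordK //=.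
  by case: ifP; rewrite ?oppr0.
- rewrite (mxtrace_class zz_class) (config_sym_trace axial_half szz) adj_trace_half.
  by rewrite nnz_mk3 eqxx oner_eq0 /octa_char inordK //=; case: ifP; rewrite ?opprK.
- rewrite (mxtrace_class e_class) (config_sym_trace axial_edge se) adj_trace_edge.
  by rewrite nnz_mk3 eqxx oner_eq0 /octa_char inordK //=; case: ifP; rewrite ?opprK.
Qed.
End OctahedralConfigurations.

(** Each special orbit adds its own contribution, each free orbit the regular
    representation, and the quadratic vector fields take away one copy of the
    fourth representation, the action of the rotations on three-space. *)
Lemma multiplicity_vector_octahedral (R : realType) (d : nat) (l : 'rV[R[i]]_d)
    (Psi : ('rV[R[i]]_d -> 'rV[R[i]]_d) -> 'S_4) (P : pred nat) (m : nat) :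
  (2 <= d)%N -> Kconf l -> Gstab_isom l Psi -> ~~ P 0%N ->
  has_type (cubic_points P) m l ->
  multiplicity_vector l Psi
    [tuple m; (P 2 + m)%N; (P 1 + P 2 + P 3 + 3 * m)%N;
           (P 1 + 2 * P 2 + P 3 + 3 * m - 1)%N; (P 2 + P 3 + 2 * m)%N].
Proof.
move=> d2 Kl hPsi P0 [a [ha a_inj [f [/is_lft_mob[Phi nzPhi ->] hS]]]] X irrX.
have [V [VE SV V_inj V_onto]] := config_points Kl P0 ha nzPhi hS.
have [rX rXE] := stab_repr Kl hPsi.
have cardE := config_card P0 ha a_inj SV V_inj V_onto.
exists rX; split=> //; apply: rsim_char_table => // k.
rewrite (octa_charE Kl hPsi P0 ha nzPhi VE SV V_inj V_onto rXE d2); congr _%:~R.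
rewrite sum_ord5 /char_table !inordK //= !(tnth_nth 0%N) /= !inordK //= /octa_char.
move: cardE {V VE SV V_inj V_onto rX rXE hS}.
case: (P 1); case: (P 2); case: (P 3) => /= cardE;
  by case: k => -[|[|[|[|[|//]]]]] ? /=; lia.
Qed.

Section CubeTypes.
Context {R : realType}.

Lemma cubic_pointsE k : cubic_points (pred1 k) = cube_points k :> set 'rV[R]_3.
Proof.
apply/seteqP; split=> v.
  by move=> [c [cc /eqP <- ->]]; apply/cube_pointsE; exists c.
by move=> /cube_pointsE[c [cc <- ->]]; exists c; rewrite /= eqxx.
Qed.

Lemma cubic_pointsU (P Q : pred nat) :
  cubic_points (predU P Q) = cubic_points P `|` cubic_points Q :> set 'rV[R]_3.
Proof.
apply/seteqP; split=> v.
  by move=> [c [cc /orP[Pc|Qc] ->]]; [left|right]; exists c.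
by case=> [[c [cc Pc ->]]|[c [cc Qc ->]]]; exists c; rewrite /= ?Pc ?Qc ?orbT.
Qed.

Lemma cubic_points0 : cubic_points pred0 = set0 :> set 'rV[R]_3.
Proof. by apply/seteqP; split=> v // [c []]. Qed.

End CubeTypes.

Theorem theorem17 (R : realType) (n : nat) (hn : (5 <= n)%N)
    (l : 'rV[R[i]]_(n - 3)) (hl : Kconf l)
    (Psi : ('rV[R[i]]_(n - 3) -> 'rV[R[i]]_(n - 3)) -> 'S_4)
    (hPsi : Gstab_isom l Psi) (m : nat) :
  (has_type F_O m l ->
    multiplicity_vector l Psi
      [tuple m; m; (1 + 3 * m)%N; (3 * m)%N; (2 * m)%N]) /\
  (has_type V_O m l ->
    multiplicity_vector l Psi
      [tuple m; m; (1 + 3 * m)%N; (3 * m)%N; (1 + 2 * m)%N]) /\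
  (has_type E_O m l ->
    multiplicity_vector l Psi
      [tuple m; (1 + m)%N; (1 + 3 * m)%N; (1 + 3 * m)%N; (1 + 2 * m)%N]) /\
  (has_type (F_O `|` V_O) m l ->
    multiplicity_vector l Psi
      [tuple m; m; (2 + 3 * m)%N; (1 + 3 * m)%N; (1 + 2 * m)%N]) /\
  (has_type (V_O `|` E_O) m l ->
    multiplicity_vector l Psi
      [tuple m; (1 + m)%N; (2 + 3 * m)%N; (2 + 3 * m)%N; (2 + 2 * m)%N]) /\
  (has_type (E_O `|` F_O) m l ->
    multiplicity_vector l Psi
      [tuple m; (1 + m)%N; (2 + 3 * m)%N; (2 + 3 * m)%N; (1 + 2 * m)%N]) /\
  (has_type (F_O `|` V_O `|` E_O) m l ->
    multiplicity_vector l Psi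
      [tuple m; (1 + m)%N; (3 + 3 * m)%N; (3 + 3 * m)%N; (2 + 2 * m)%N]) /\
  (has_type set0 (1 + m) l ->
    multiplicity_vector l Psi
      [tuple (1 + m)%N; (1 + m)%N; (3 + 3 * m)%N; (2 + 3 * m)%N;
             (2 + 2 * m)%N]).
Proof.
have d2 : (2 <= n - 3)%N by rewrite leq_subRL // (leq_trans _ hn).
have main (P : pred nat) m' (q : 5.-tuple nat) : ~~ P 0%N ->
    [:: m'; P 2 + m'; P 1 + P 2 + P 3 + 3 * m';
        P 1 + 2 * P 2 + P 3 + 3 * m' - 1; P 2 + P 3 + 2 * m']%N = q ->
    has_type (cubic_points P) m' l -> multiplicity_vector l Psi q.
  move=> P0 eq_q type_l; have := multiplicity_vector_octahedral d2 hl hPsi P0 type_l.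
  by congr (multiplicity_vector _ _ _); apply: val_inj.
rewrite /F_O /V_O /E_O -!cubic_pointsE -!cubic_pointsU -cubic_points0.
by do 7?[split; first by apply: main => //=; congr [:: _; _; _; _; _]; lia];
  apply: main => //=; congr [:: _; _; _; _; _]; lia.
Qed.
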